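(* Let $p>2$ be a prime, $\mathbf{F}$ a field of characteristic $p$, $M=(c_{ij})\in\mathbf{F}^{2\times3}$, and let $V_M$ be the associated three-dimensional representation of $G=(\mathbf{Z}/p)^3=\langle e_1,e_2,e_3\rangle$, so that $G$ acts on $\mathbf{F}[V_M]=\mathbf{F}[x,y,z]$ by algebra automorphisms with $x\cdot e_i=x$, $y\cdot e_i=y+c_{1i}x$, $z\cdot e_i=z+2c_{1i}y+(c_{1i}^2+c_{2i})x$ for $i=1,2,3$. Suppose $V_M$ is faithful with $\overline\gamma_{123}=\overline\gamma_{135}=0$ and $\overline\gamma_{124}\neq0$, and let the generators of $G$ and the basis of $V_M$ be chosen so that $$M=\begin{pmatrix}1&c_{12}&0\\0&c_{22}&c_{23}\end{pmatrix}$$ (as is always possible; see context). Let $g$ be as defined in the context. Then $\{x,N_G(y),g,N_G(z)\}$ is a SAGBI basis for $\mathbf{F}[V_M]^G$ with respect to the graded reverse lexicographic order with $x<y<z$. Furthermore, there is a single relation among the generators, constructed by subducting $N_G(y)^{p^2+1}-g^p$.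
   Context: Let $\delta=y^2-xz$. Let $\overline\gamma_{ijk}\in\mathbf{F}$ be the $3\times3$ minor, on rows $i<j<k$, of the matrix whose rows $1,\ldots,5$ are $(c_{11},c_{12},c_{13})$, $(c_{21},c_{22},c_{23})$, $(c_{11}^p,c_{12}^p,c_{13}^p)$, $(c_{21}^p,c_{22}^p,c_{23}^p)$, $(c_{11}^{p^2},c_{12}^{p^2},c_{13}^{p^2})$. For a polynomial $f$, $N_G(f)$ is the product of the (distinct) elements of the $G$-orbit of $f$. Changing generators of $G$ corresponds to right multiplication of $M$ by an element of $GL_3(\mathbf{F}_p)$; suitable changes of basis of $V_M$ correspond to left multiplication of $M$ by $\begin{pmatrix}\alpha&0\\ \alpha\gamma&\alpha^2\end{pmatrix}$ with $\alpha\in\mathbf{F}^*$, $\gamma\in\mathbf{F}$. When $\overline\gamma_{123}=\overline\gamma_{135}=0$ and $\overline\gamma_{124}\ne0$, such changes (which preserve these conditions) bring $M$ to the displayed form. For $M$ in this form and $V_M$ faithful, one has $c_{23}\neq0$, $c_{12}\in\mathbf{F}_p$, $N_G(y)=y^p-yx^{p-1}$, and $N_G(\delta)=\prod_{u\in U}(\delta-ux^2)$, where $U=\mathrm{Span}_{\mathbf{F}_p}\{c_{22},c_{23}\}$ has order $p^2$. Define $$\widetilde g=N_G(\delta)-N_G(y)^{2p}-2N_G(y)^{p+1}x^{p(p-1)},\qquad g=\frac{\widetilde g}{2x^{p^2-1}},$$ where $g$ is a polynomial with lead term $y^{p^2+1}$. A subset $\mathcal{B}$ of a subalgebra $A$ of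 a polynomial ring is a SAGBI basis for $A$ if the lead monomials of the elements of $\mathcal{B}$ generate, as an algebra, the lead term algebra of $A$ (the algebra spanned by the lead monomials of nonzero elements of $A$); then $\mathcal{B}$ generates $A$. To subduct a polynomial $F$ over $\mathcal{B}$ is to repeatedly subtract from it scalar multiples of products of elements of $\mathcal{B}$ having the same lead term as the current polynomial; for a SAGBI basis, every $F\in A$ subducts to $0$. If $F$ is a polynomial expression in elements of $\mathcal{B}$, its subduction to $0$ yields an identity $F-\sum_I c_I\,b^I=0$ with products $b^I$ of elements of $\mathcal{B}$: this is the relation constructed by subducting $F$. ''A single relation'' means that the ideal of all algebraic relations among the listed generators is generated by that one relation. *)

(* Defs.v *)
From mathcomp Require Import all_boot all_order all_algebra.
From mathcomp.multinomials Require Export mpoly.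

Set Implicit Arguments.
Unset Strict Implicit.
Unset Printing Implicit Defensive.

Import GRing.Theory.
Local Open Scope ring_scope.

Section Monomials.
Variables (F : fieldType) (n : nat).

(* Graded reverse lexicographic order with 'X_0 < 'X_1 < ... < 'X_(n-1): in
   equal degree, the monomial with the larger exponent in the least variable
   where they differ is the smaller one.  The order built into mpoly is the
   graded lexicographic order, hence mlead is not used below. *)
Definition grevlex_lt (m1 m2 : 'X_{1..n}) : bool :=
  (mdeg m1 < mdeg m2)%N ||
  (mdeg m1 == mdeg m2) &&
  [exists i : 'I_n, (m2 i < m1 i)%N &&
     [forall j : 'I_n, (j < i)%N ==> (m1 j == m2 j)]].

Definition grevlex_max (m1 m2 : 'X_{1..n}) : 'X_{1..n} :=
  if grevlex_lt m1 m2 then m2 else m1.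

(* Exponent of the lead monomial of f when f != 0; 0 when f = 0. *)
Definition lead_mon (f : {mpoly F[n]}) : 'X_{1..n} :=
  \big[grevlex_max/0%MM]_(m <- msupp f) m.

Definition lead_term (f : {mpoly F[n]}) : {mpoly F[n]} :=
  f@_(lead_mon f) *: 'X_[lead_mon f].

Inductive alg_gen (S : {mpoly F[n]} -> Prop) : {mpoly F[n]} -> Prop :=
| alg_gen_mem f : S f -> alg_gen S f
| alg_gen_const c : alg_gen S c%:MP
| alg_gen_add f h : alg_gen S f -> alg_gen S h -> alg_gen S (f + h)
| alg_gen_mul f h : alg_gen S f -> alg_gen S h -> alg_gen S (f * h).

Inductive lin_span (S : {mpoly F[n]} -> Prop) : {mpoly F[n]} -> Prop :=
| lin_span0 : lin_span S 0
| lin_span_add c f h : S f -> lin_span S h -> lin_span S (c *: f + h).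

Definition lead_monomials (S : {mpoly F[n]} -> Prop) : {mpoly F[n]} -> Prop :=
  fun m => exists f, [/\ S f, f != 0 & m = 'X_[lead_mon f]].

Definition sagbi_basis (A B : {mpoly F[n]} -> Prop) : Prop :=
  (forall f, B f -> A f) /\
  (forall f, alg_gen (lead_monomials B) f <-> lin_span (lead_monomials A) f).

(* subducts_to0 B h S: some subduction of h over B ends at 0, and S is the
   formal sum, in variables standing for the entries of B, of the scalar
   multiples of products of elements of B that were subtracted. *)
Inductive subducts_to0 (k : nat) (B : k.-tuple {mpoly F[n]}) :
    {mpoly F[n]} -> {mpoly F[k]} -> Prop :=
| subducts_nil : subducts_to0 B 0 0
| subducts_step h (c : F) (I : 'X_{1..k}) S :
    h != 0 ->
    lead_term (c *: ('X_[I] \mPo B)) = lead_term h ->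
    subducts_to0 B (h - c *: ('X_[I] \mPo B)) S ->
    subducts_to0 B h (c *: 'X_[I] + S).

End Monomials.

Section Representation.
Variables (F : fieldType) (p : nat) (M : 'M[F]_(2, 3)).

Definition x : {mpoly F[3]} := 'X_(0 : 'I_3).
Definition y : {mpoly F[3]} := 'X_(1 : 'I_3).
Definition z : {mpoly F[3]} := 'X_(2 : 'I_3).

Definition act_gen (i : 'I_3) (f : {mpoly F[3]}) : {mpoly F[3]} :=
  f \mPo [tuple x;
                y + M 0 i *: x;
                z + (2 * M 0 i) *: y + (M 0 i ^+ 2 + M 1 i) *: x].

(* The right action of e_1^a_1 e_2^a_2 e_3^a_3, the element of (Z/p)^3 with
   coordinates a. *)
Definition act (a : 'rV['F_p]_3) (f : {mpoly F[3]}) : {mpoly F[3]} :=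
  iter (a 0 2) (act_gen 2) (iter (a 0 1) (act_gen 1) (iter (a 0 0) (act_gen 0) f)).

Definition faithful : Prop := forall a, (forall f, act a f = f) -> a = 0.

Definition G_invariant (f : {mpoly F[3]}) : Prop := forall a, act a f = f.

Definition orbit_prod (f : {mpoly F[3]}) : {mpoly F[3]} :=
  \prod_(h <- undup [seq act a f | a : 'rV['F_p]_3]) h.

(* Rows are numbered from 1: row k is row 1 (k odd) or row 2 (k even) of M
   raised entrywise to the power p ^ ((k - 1) / 2). *)
Definition gamma_row (k : nat) : 'rV[F]_3 :=
  \row_j M (if odd k then 0 else 1) j ^+ (p ^ (k.-1)./2).

Definition gamma (i j k : nat) : F :=
  \det (\matrix_(r < 3) gamma_row (nth 0%N [:: i; j; k] r)).

Definition delta : {mpoly F[3]} := y ^+ 2 - x * z.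

Definition gtilde : {mpoly F[3]} :=
  orbit_prod delta - orbit_prod y ^+ (2 * p)
    - 2 * orbit_prod y ^+ p.+1 * x ^+ (p * (p - 1)).

End Representation.

Arguments x {F}.
Arguments y {F}.
Arguments z {F}.
Arguments delta {F}.

Definition normal_form (F : fieldType) (c12 c22 c23 : F) : 'M[F]_(2, 3) :=
  \matrix_(i, j) nth 0 (nth [::] [:: [:: 1; c12; 0]; [:: 0; c22; c23]] i) j.

(* Main.v *)
(* Let U be the F_p-span of c22, c23.  The group consists of the (t, s) with t in
   F_p and s in U, acting by y -> y + t x, z -> z + 2 t y + (t^2 + s) x and delta -> delta - s x^2.

   Expanding N(delta) by additivity of X -> prod_(s in U) (X - s) gives
   2 g = q(x, y) - x prod_(s in U) (z + s x) for an explicit q.  As g is invariant,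
   2 g = q(x, y + t x) - x prod_s (z + 2 t y + (t^2 + s) x) for every t in F_p, and
   multiplying over t yields x^p N(z) = prod_t (q(x, y + t x) - 2 g).  The
   coefficients of this product as a polynomial in g are invariant under y -> y + t x,
   hence lie in F[x, N(y)]: so g^p is a combination of x^p N(z) and of the g^i, i < p,
   over F[x, N(y)].

   The monomials x^a N(y)^b g^c N(z)^d with c < p have distinct lead monomials
   x^a y^(p b + (p^2 + 1) c) z^(p^3 d).  Rewriting g^p therefore gives normal forms in
   the subalgebra A generated by x, N(y), g, N(z); these normal forms show that the
   relation generates the ideal of relations, that the lead monomials of A are as
   expected, that subduction follows the normal form term by term, and that
   A cap x F[V] = x A.

   In the coordinates Y = y / x and W = delta / x^2 the group acts by translations
   Y -> Y + t, W -> W - s, whose invariants are generated by the two norms; hence every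
   invariant lies in A after multiplication by a power of x, and so in A. *)
From HB Require Import structures.
Require Import Defs.
From mathcomp Require Import all_boot all_order all_algebra.
From mathcomp Require Import ring zify.
Set Implicit Arguments.
Unset Strict Implicit.
Unset Printing Implicit Defensive.
Import GRing.Theory.
Local Open Scope ring_scope.

(** * Graded reverse lexicographic leads and subduction *)

Section Grevlex.
Variable n : nat.
Implicit Types m : 'X_{1..n}.

Lemma grevlex_ltP m1 m2 :
  reflect ((mdeg m1 < mdeg m2)%N \/ mdeg m1 = mdeg m2 /\
           exists i : 'I_n, (m2 i < m1 i)%N /\
             forall j : 'I_n, (j < i)%N -> m1 j = m2 j)
          (grevlex_lt m1 m2).
Proof.
apply: (iffP orP) => [[lt_d|/andP[/eqP eq_d /existsP[i /andP[lt_i /forallP eq_j]]]]|].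
- by left.
- right; split=> //; exists i; split=> // j lt_j.
  by apply/eqP; apply: (implyP (eq_j j)).
- case=> [lt_d|[eq_d [i [lt_i eq_j]]]]; [by left | right].
  rewrite eq_d eqxx; apply/existsP; exists i; rewrite lt_i.
  by apply/forallP => j; apply/implyP => /eq_j ->.
Qed.

Lemma grevlex_irr m : grevlex_lt m m = false.
Proof. by apply/grevlex_ltP; case=> [|[_ [i []]]]; rewrite ltnn. Qed.

Lemma grevlex_trans m2 m1 m3 :
  grevlex_lt m1 m2 -> grevlex_lt m2 m3 -> grevlex_lt m1 m3.
Proof.
move=> /grevlex_ltP[d12|[d12 [i [lt_i eq_i]]]] /grevlex_ltP[d23|[d23 [j [lt_j eq_j]]]];
  apply/grevlex_ltP; [left; lia | left; lia | left; lia | right].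
split; first lia.
case: (ltngtP i j) => [lt_ij|lt_ji|/val_inj eq_ij].
- exists i; split; first by rewrite -(eq_j _ lt_ij).
  by move=> k lt_k; rewrite eq_i // eq_j //; lia.
- exists j; split; first by rewrite (eq_i _ lt_ji).
  by move=> k lt_k; rewrite eq_i ?eq_j //; lia.
- subst j; exists i; split; first lia.
  by move=> k lt_k; rewrite eq_i // eq_j.
Qed.

Lemma grevlex_total m1 m2 : [|| grevlex_lt m1 m2, m1 == m2 | grevlex_lt m2 m1].
Proof.
case: (ltngtP (mdeg m1) (mdeg m2)) => [d12|d12|d12].
- by apply/orP; left; apply/grevlex_ltP; left.
- by apply/or3P/Or33/grevlex_ltP; left.
case: (pickP (fun i : 'I_n => m1 i != m2 i)) => [i0 ne_i0|eq_m]; last first.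
  suff -> : m1 = m2 by rewrite eqxx orbT.
  by apply/mnmP => i; apply/eqP/negbFE/eq_m.
case: (@arg_minnP _ i0 (fun i => m1 i != m2 i) val ne_i0) => i ne_i min_i.
have eq_j (j : 'I_n) : (j < i)%N -> m1 j = m2 j.
  by move=> lt_j; apply/eqP; apply: contraLR lt_j; rewrite -leqNgt; apply: min_i.
have := ne_i; rewrite neq_ltn => /orP[lt_i|lt_i]; apply/or3P.
  apply: Or33; apply/grevlex_ltP; right; split=> //.
  by exists i; split=> // j /eq_j.
by apply: Or31; apply/grevlex_ltP; right; split=> //; exists i.
Qed.

Lemma grevlex_add2l m m1 m2 :
  grevlex_lt m1 m2 -> grevlex_lt (m + m1)%MM (m + m2)%MM.
Proof.
move=> /grevlex_ltP[lt_d|[eq_d [i [lt_i eq_j]]]]; apply/grevlex_ltP.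
  by left; rewrite !mdegD ltn_add2l.
right; rewrite !mdegD eq_d; split=> //; exists i; rewrite !mnmDE ltn_add2l.
by split=> // j /eq_j; rewrite !mnmDE => ->.
Qed.

Lemma grevlex_add m1 m2 m3 m4 :
  grevlex_lt m1 m2 -> grevlex_lt m3 m4 -> grevlex_lt (m1 + m3)%MM (m2 + m4)%MM.
Proof.
move=> lt12 lt34; apply: (grevlex_trans (grevlex_add2l m1 lt34)).
by rewrite ![(_ + m4)%MM]addmC; apply: grevlex_add2l.
Qed.

(** Several elements may share the largest key; uniqueness of the maximum is obtained later, where
    the key is injective. *)
Lemma grevlex_max_key (T : eqType) (key : T -> 'X_{1..n}) (s : seq T) :
  s != [::] -> exists2 t, t \in s &
    {in s, forall u, (key u == key t) || grevlex_lt (key u) (key t)}.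
Proof.
elim: s => // a s IHs _; case: (altP (s =P [::])) => [->|/IHs[t t_s max_t]].
  by exists a; rewrite ?mem_head // => u; rewrite inE => /eqP ->; rewrite eqxx.
case: (boolP (grevlex_lt (key t) (key a))) => [lt_ta|nlt_ta].
  exists a; first exact: mem_head.
  move=> u; rewrite inE => /orP[/eqP ->|/max_t]; first by rewrite eqxx.
  case/orP=> [/eqP ->|lt_ut]; first by rewrite lt_ta orbT.
  by rewrite (grevlex_trans lt_ut lt_ta) orbT.
exists t; first by rewrite inE t_s orbT.
move=> u; rewrite inE => /orP[/eqP ->|/max_t //].
by have := grevlex_total (key a) (key t); rewrite (negPf nlt_ta) orbF orbC.
Qed.

End Grevlex.

(** * Lead terms of sums and products *)

Section Leads.
Variables (F : fieldType) (n : nat).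
Implicit Types (f g r : {mpoly F[n]}) (m : 'X_{1..n}).

Definition lower m f := {in msupp f, forall m', grevlex_lt m' m}.

(** The scalar c may be 0, so products can be formed without nonvanishing conditions;
    [lead_mon_uniq] passes to [lead_mon] once c is nonzero. *)
Definition has_lead f (c : F) m := lower m (f - c *: 'X_[m]).

Lemma lower0 m : lower m 0.
Proof. by move=> m'; rewrite msupp0. Qed.

Lemma lowerD m f g : lower m f -> lower m g -> lower m (f + g).
Proof. by move=> lf lg m' /msuppD_le; rewrite mem_cat => /orP[/lf|/lg]. Qed.

Lemma lowerZ m c f : lower m f -> lower m (c *: f).
Proof. by move=> lf m' /msuppZ_le/lf. Qed.

Lemma lower_sum m (I : eqType) (s : seq I) (P : pred I) (E : I -> {mpoly F[n]}) :
  {in s, forall i, P i -> lower m (E i)} -> lower m (\sum_(i <- s | P i) E i).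
Proof.
move=> lE; rewrite big_seq_cond; elim/big_rec: _ => [|i f /andP[/lE lEi /lEi lEf] lf].
  exact: lower0.
exact: lowerD.
Qed.

Lemma lowerM m m' f g : lower m f -> lower m' g -> lower (m + m') (f * g).
Proof.
move=> lf lg k /msuppM_le/allpairsP[[k1 k2] /= [/lf k1m /lg k2m ->]].
exact: grevlex_add.
Qed.

Lemma lowerMX m m' f : lower m f -> lower (m' + m) ('X_[m'] * f).
Proof.
move=> lf k /msuppM_le/allpairsP[[k1 k2] /= []].
by rewrite msuppX inE => /eqP -> /lf k2m ->; apply: grevlex_add2l.
Qed.

Lemma lower_trans m m' f : lower m f -> grevlex_lt m m' -> lower m' f.
Proof. by move=> lf lt_m k /lf lt_k; apply: grevlex_trans lt_m. Qed.

Lemma has_lead_lower f c m m' : has_lead f c m -> grevlex_lt m m' -> lower m' f.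
Proof.
move=> lf lt_m; rewrite -[f](subrK (c *: 'X_[m])); apply: lowerD.
  exact: lower_trans lt_m.
by apply: lowerZ => k; rewrite msuppX inE => /eqP ->.
Qed.

Lemma has_leadX m : has_lead 'X_[m] 1 m.
Proof. by rewrite /has_lead scale1r subrr; apply: lower0. Qed.

Lemma has_leadM f g c d m m' :
  has_lead f c m -> has_lead g d m' -> has_lead (f * g) (c * d) (m + m').
Proof.
rewrite /has_lead; set f' := _ - _; set g' := g - _ => lf lg.
have -> : f * g - (c * d) *: 'X_[m + m'] =
    f' * g' + c *: ('X_[m] * g') + d *: ('X_[m'] * f').
  rewrite /f' /g' mpolyXD -!mul_mpolyC rmorphM /=; ring.
apply: lowerD; first apply: lowerD; first exact: lowerM.
  by apply/lowerZ/lowerMX.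
by rewrite addmC; apply/lowerZ/lowerMX.
Qed.

Lemma has_lead_prod (I : Type) (s : seq I) (f : I -> {mpoly F[n]}) m :
  (forall i, has_lead (f i) 1 m) -> has_lead (\prod_(i <- s) f i) 1 (m *+ size s).
Proof.
move=> lf; elim: s => [|i s IHs]; first by rewrite big_nil -mpolyX0; apply: has_leadX.
by rewrite big_cons mulmS; have := has_leadM (lf i) IHs; rewrite mulr1.
Qed.

Lemma has_leadXn f m k : has_lead f 1 m -> has_lead (f ^+ k) 1 (m *+ k).
Proof.
move=> lf; have := @has_lead_prod _ (iota 0 k) (fun=> f) m (fun=> lf).
by rewrite size_iota big_const_seq count_predT size_iota -Monoid.iteropE.
Qed.

Lemma has_lead_prod_mon k (e : 'I_k -> 'X_{1..n}) (f : 'I_k -> {mpoly F[n]})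
    (I : 'I_k -> nat) (s : seq 'I_k) :
  (forall i, has_lead (f i) 1 (e i)) ->
  has_lead (\prod_(i <- s) f i ^+ I i) 1 (\big[+%MM/0%MM]_(i <- s) (e i *+ I i)%MM).
Proof.
move=> lf; elim: s => [|i s IHs]; first by rewrite !big_nil -mpolyX0; apply: has_leadX.
by rewrite !big_cons; have := has_leadM (has_leadXn (k := I i) (lf i)) IHs; rewrite mulr1.
Qed.

Lemma has_lead_coef f c m : has_lead f c m -> f@_m = c.
Proof.
move=> lf; have: (f - c *: 'X_[m])@_m = 0.
  by apply: memN_msupp_eq0; apply/negP => /lf; rewrite grevlex_irr.
by rewrite mcoeffB mcoeffZ mcoeffX eqxx mulr1 => /subr0_eq.
Qed.

Lemma has_lead_max f c m m' :
  has_lead f c m -> m' \in msupp f -> m' != m -> grevlex_lt m' m.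
Proof.
move=> lf m'f ne_m'; apply: lf; rewrite mcoeff_msupp mcoeffB mcoeffZ mcoeffX.
by rewrite [m == _]eq_sym (negPf ne_m') mulr0 subr0 -mcoeff_msupp.
Qed.

Lemma lead_mon_max f m : m \in msupp f -> (m == lead_mon f) || grevlex_lt m (lead_mon f).
Proof.
rewrite /lead_mon; elim: (msupp f) => // a s IHs.
rewrite big_cons inE; move: (bigop _ _ _) IHs => M IHs; rewrite /grevlex_max.
case: ifPn => [lt_a|nlt_a] /orP[/eqP ->|/IHs //].
- by rewrite lt_a orbT.
- by rewrite eqxx.
have := grevlex_total a M; rewrite (negPf nlt_a) /= => /orP[/eqP <-//|lt_Ma].
by case/orP=> [/eqP->|lt_mM]; rewrite ?lt_Ma ?(grevlex_trans lt_mM lt_Ma) orbT.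
Qed.

Lemma lead_mon_in f : f != 0 -> lead_mon f \in msupp f.
Proof.
rewrite -msupp_eq0 /lead_mon; elim: (msupp f) => // a s IHs _.
rewrite big_cons /grevlex_max; case: ifPn => [lt_a|_]; last exact: mem_head.
rewrite inE; case: (altP (s =P [::])) lt_a => [->|/IHs -> _]; last by rewrite orbT.
(* The default 0 of the fold is the least monomial, so it never displaces a member of the
   support. *)
rewrite big_nil => /grevlex_ltP[|[d0 [i []]]]; first by rewrite mdeg0.
by move: d0; rewrite mdeg0 => /eqP; rewrite mdeg_eq0 => /eqP ->; rewrite mnm0E.
Qed.

Lemma has_lead_mon f : has_lead f f@_(lead_mon f) (lead_mon f).
Proof.
move=> m; rewrite mcoeff_msupp mcoeffB mcoeffZ mcoeffX.
case: (eqVneq (lead_mon f) m) => [<-|ne_m]; first by rewrite mulr1 subrr eqxx.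
rewrite mulr0 subr0 -mcoeff_msupp => /lead_mon_max.
by rewrite eq_sym (negPf ne_m).
Qed.

Lemma lead_mon_uniq f c m : c != 0 -> has_lead f c m -> f != 0 /\ lead_mon f = m.
Proof.
move=> c0 lf; have mf : m \in msupp f by rewrite mcoeff_msupp (has_lead_coef lf).
have f0 : f != 0 by apply: contraTneq mf => ->; rewrite msupp0.
split=> //; apply/eqP; apply: contraT => ne_m.
have lt1 := has_lead_max lf (lead_mon_in f0) ne_m.
have := lead_mon_max mf; rewrite eq_sym (negPf ne_m) /= => /(grevlex_trans lt1).
by rewrite grevlex_irr.
Qed.

Lemma lead_monM f g : f != 0 -> g != 0 ->
  lead_mon (f * g) = (lead_mon f + lead_mon g)%MM.
Proof.
move=> f0 g0; have c0 : f@_(lead_mon f) * g@_(lead_mon g) != 0.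
  by rewrite mulf_neq0 // -mcoeff_msupp lead_mon_in.
by case: (lead_mon_uniq c0 (has_leadM (@has_lead_mon f) (@has_lead_mon g))).
Qed.

Lemma lin_span_mem (S : {mpoly F[n]} -> Prop) f : S f -> lin_span S f.
Proof.
by move=> Sf; rewrite -[f]addr0 -[f]scale1r; apply: lin_span_add => //; apply: lin_span0.
Qed.

Lemma lin_spanD (S : {mpoly F[n]} -> Prop) f g :
  lin_span S f -> lin_span S g -> lin_span S (f + g).
Proof.
by move=> Sf Sg; elim: Sf => [|c f1 f2 Sf1 _ IH]; rewrite ?add0r // -addrA; apply: lin_span_add.
Qed.

Lemma lin_spanZ (S : {mpoly F[n]} -> Prop) c f : lin_span S f -> lin_span S (c *: f).
Proof.
elim=> [|d f1 f2 Sf1 _ IH]; first by rewrite scaler0; apply: lin_span0.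
by rewrite scalerDr scalerA; apply: lin_span_add.
Qed.

Lemma lin_spanM (S : {mpoly F[n]} -> Prop) f g :
    (forall f1 g1, S f1 -> S g1 -> S (f1 * g1)) ->
  lin_span S f -> lin_span S g -> lin_span S (f * g).
Proof.
move=> SM Sf Sg; elim: Sf => [|c f1 f2 Sf1 _ IH]; first by rewrite mul0r; apply: lin_span0.
rewrite mulrDl; apply: lin_spanD => //; rewrite -scalerAl; apply: lin_spanZ.
elim: Sg => [|d g1 g2 Sg1 _ IHg]; first by rewrite mulr0; apply: lin_span0.
rewrite mulrDr -scalerAr; apply: lin_span_add => //; exact: SM.
Qed.

(* The lead monomials of a subalgebra are closed under products, so that their
   span is an algebra. *)
Lemma alg_gen_lead_sub (A B : {mpoly F[n]} -> Prop) f :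
    (forall h, B h -> A h) -> A 1 -> (forall h1 h2, A h1 -> A h2 -> A (h1 * h2)) ->
  alg_gen (lead_monomials B) f -> lin_span (lead_monomials A) f.
Proof.
move=> BA A1 AM; elim=> {f} [f [h [Bh h0 ->]]|c|f h _ IHf _ IHh|f h _ IHf _ IHh].
- by apply: lin_span_mem; exists h; split=> //; apply: BA.
- have l1 : has_lead (1 : {mpoly F[n]}) 1 0%MM by rewrite -mpolyX0; apply: has_leadX.
  have -> : c%:MP = c *: 'X_[lead_mon (1 : {mpoly F[n]})].
    by case: (lead_mon_uniq (oner_neq0 _) l1) => _ ->; rewrite mpolyX0 -mul_mpolyC mulr1.
  by apply/lin_spanZ/lin_span_mem; exists 1; rewrite oner_neq0.
- exact: lin_spanD.
apply: lin_spanM => // _ _ [f1 [Af1 f10 ->]] [g1 [Ag1 g10 ->]].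
by exists (f1 * g1); rewrite mulf_neq0 // lead_monM // mpolyXD; split=> //; apply: AM.
Qed.

End Leads.

(** * Polynomials in generators whose normal terms have distinct lead monomials *)

Section Triangular.
Variables (F : fieldType) (n k : nat) (B : k.-tuple {mpoly F[n]}).
Variable (e : 'I_k -> 'X_{1..n}).
Hypothesis lead_B : forall i, has_lead (tnth B i) 1 (e i).
Variable normal : pred 'X_{1..k}.

Definition mon_lead (I : 'X_{1..k}) : 'X_{1..n} := (\big[+%MM/0%MM]_(i < k) (e i *+ I i))%MM.

Hypothesis mon_lead_inj : {in normal &, injective mon_lead}.

Definition all_normal (P : {mpoly F[k]}) := {in msupp P, forall I, normal I}.

Lemma has_lead_mon_comp I : has_lead ('X_[I] \mPo B) 1 (mon_lead I).
Proof. by rewrite comp_mpolyX; apply: has_lead_prod_mon. Qed.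

(** Distinct normal terms have distinct lead monomials, so the largest of these cannot cancel. *)
Lemma lead_comp (P : {mpoly F[k]}) : all_normal P -> P != 0 ->
  exists2 I, I \in msupp P & has_lead (P \mPo B) P@_I (mon_lead I).
Proof.
move=> nP P0; have [|I IP maxI] := @grevlex_max_key _ _ mon_lead (msupp P).
  by rewrite msupp_eq0.
exists I => //; rewrite /has_lead {1}(comp_mpolyEX P B) (bigD1_seq I) ?msupp_uniq //=.
rewrite addrAC -scalerBr; apply: lowerD.
  by rewrite -[X in _ - X]scale1r; apply: lowerZ; apply: has_lead_mon_comp.
apply: lower_sum => J JP neJI; apply: lowerZ; apply: has_lead_lower (@has_lead_mon_comp J) _.
case/orP: (maxI J JP) => // /eqP/mon_lead_inj eqJI.
by move: neJI; rewrite eqJI ?eqxx //; apply: nP.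
Qed.

Lemma comp_normal_eq0 (P : {mpoly F[k]}) : all_normal P -> P \mPo B = 0 -> P = 0.
Proof.
move=> nP PB0; apply/eqP; apply: contraT => P0; have [I IP] := lead_comp nP P0.
move: IP; rewrite mcoeff_msupp => c0 /(lead_mon_uniq c0)[].
by rewrite PB0 eqxx.
Qed.

(** Each step subtracts the term of P with the largest lead monomial. What remains is normal with
    one term fewer, so the subduction strips P term by term and records P itself. *)
Lemma subducts_comp (P : {mpoly F[k]}) : all_normal P -> subducts_to0 B (P \mPo B) P.
Proof.
have [N] := ubnP (size (msupp P)); elim: N P => // N IHN P ltN nP.
case: (altP (P =P 0)) => [->|P0]; first by rewrite comp_mpoly0; apply: subducts_nil.
have [I IP lI] := lead_comp nP P0; have cI : P@_I != 0 by rewrite -mcoeff_msupp.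
have [h0 lh] := lead_mon_uniq cI lI.
have defP : P@_I *: 'X_[I] + (P - P@_I *: 'X_[I]) = P by rewrite addrC subrK.
(* Only the recorded sum is rewritten, to expose the term subtracted first. *)
rewrite -{2}defP.
have lt_msupp := msupp_rem P I.
apply: subducts_step => //.
  have lcI : has_lead (P@_I *: ('X_[I] \mPo B)) P@_I (mon_lead I).
    by rewrite /has_lead -scalerBr; apply: lowerZ; rewrite -[X in _ - X]scale1r; apply: has_lead_mon_comp.
  have [_ lcI'] := lead_mon_uniq cI lcI.
  by rewrite /lead_term lcI' lh (has_lead_coef lcI) (has_lead_coef lI).
rewrite -comp_mpolyZ -comp_mpolyB; apply: IHN.
  rewrite (perm_size lt_msupp) size_rem //.
  by case: (msupp P) IP ltN => // a s _ /=; rewrite ltnS.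
by move=> J; rewrite (perm_mem lt_msupp) => /mem_rem/nP.
Qed.

End Triangular.

(** * Polynomials invariant under translations *)

Lemma prod_XsubC_dvd (R : idomainType) (P : {poly R}) (rs : seq R) :
  uniq rs -> all (root P) rs -> exists Q, P = Q * \prod_(c <- rs) ('X - c%:P).
Proof.
elim: rs P => [|a rs IHrs] P /=; first by exists P; rewrite big_nil mulr1.
case/andP=> rs'a uniq_rs /andP[/factor_theorem[P1 ->] /allP rootP].
have [|Q ->] := IHrs P1 uniq_rs; last by exists Q; rewrite big_cons mulrCA mulrC mulrA.
apply/allP => b rsb; have := rootP b rsb; rewrite rootM root_XsubC.
by case/orP=> // /eqP eq_ba; rewrite -eq_ba rsb in rs'a.
Qed.

Section ShiftInvariants.
Variables (R : idomainType) (J : finZmodType) (r : J -> R).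
Hypotheses (rD : {morph r : i j / i + j}) (r_inj : injective r).

Definition shift_norm : {poly R} := \prod_j ('X - (r j)%:P).

Definition shift j (P : {poly R}) := P \Po ('X + (r j)%:P).

Lemma shift_shift_norm j : shift j shift_norm = shift_norm.
Proof.
rewrite /shift /shift_norm rmorph_prod /= (reindex_inj (addIr j)) /=.
apply: eq_bigr => i _.
by rewrite rmorphB /= comp_polyX comp_polyC rD polyCD /= opprD addrACA subrr addr0.
Qed.

Lemma size_shift_norm : size shift_norm = #|J|.+1.
Proof. by rewrite /shift_norm size_prod_XsubC /index_enum -enumT -cardE. Qed.

Lemma card_J_gt0 : (0 < #|J|)%N.
Proof. by apply/card_gt0P; exists 0. Qed.

Lemma shift_norm_neq0 : shift_norm != 0.
Proof. by rewrite -size_poly_eq0 size_shift_norm. Qed.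

Lemma comp_shift_norm_inj : injective (comp_poly shift_norm).
Proof.
move=> P Q eqPQ; apply/eqP; rewrite -subr_eq0 -(@comp_poly_eq0 _ _ shift_norm).
  by rewrite comp_polyB eqPQ subrr.
by rewrite size_shift_norm ltnS card_J_gt0.
Qed.

(* [P - P(0)] vanishes at all the shifts, so it is a multiple of their norm, and
   the quotient is again invariant. *)
Lemma shift_invariantP (P : {poly R}) :
  (forall j, shift j P = P) -> exists Q, P = Q \Po shift_norm.
Proof.
have [N] := ubnP (size P); elim: N P => // N IHN P ltN invP.
have [szP|szP] := leqP (size P) 1.
  by exists P; rewrite {2}(size1_polyC szP) comp_polyC -size1_polyC.
pose c := P.[0].
have [||Q defP] := @prod_XsubC_dvd _ (P - c%:P) [seq r j | j <- index_enum J].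
- by rewrite map_inj_uniq ?index_enum_uniq.
- apply/allP => _ /mapP[j _ ->]; rewrite rootE hornerD hornerN hornerC.
  by rewrite /c -{2}(invP j) /shift horner_comp hornerD hornerX hornerC add0r subrr.
move: defP; rewrite big_map -/shift_norm => defP.
have Q0 : Q != 0.
  apply: contraTneq szP => Q0; move: defP; rewrite Q0 mul0r => /subr0_eq ->.
  by rewrite size_polyC -leqNgt; case: (c == 0).
have szPc : size (P - c%:P) = size P.
  by rewrite size_polyDl // size_polyN (leq_ltn_trans (size_polyC_leq1 _)).
have szQ : (size Q < size P)%N.
  rewrite -szPc defP size_mul ?shift_norm_neq0 // size_shift_norm addnS /=.
  by rewrite -[X in (X < _)%N]addn0 ltn_add2l card_J_gt0.
have invQ j : shift j Q = Q.
  apply: (mulIf shift_norm_neq0); rewrite -defP -[in LHS](shift_shift_norm j).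
  rewrite /shift -comp_polyM -defP comp_polyB comp_polyC.
  by have := invP j; rewrite /shift => ->.
have [Q' defQ] := IHN Q (leq_trans szQ ltN) invQ.
exists (Q' * 'X + c%:P); rewrite comp_polyD comp_polyM comp_polyX comp_polyC -defQ -defP.
by rewrite subrK.
Qed.

(** A further shift permutes the factors, hence fixes each coefficient of the product; by
    [shift_invariantP] the coefficients are polynomials in the norm. *)
Lemma norm_shift_coef (q : {poly R}) :
  exists c : nat -> {poly R},
    \prod_j ('X - (shift j q)%:P) =
    'X^#|J| + \sum_(i < #|J|) (c i \Po shift_norm) *: 'X^i.
Proof.
set P := \prod_j _.
have invP j i : shift j P`_i = P`_i.
  rewrite -[in RHS](_ : map_poly (comp_poly ('X + (r j)%:P)) P = P) ?coef_map //.
  rewrite rmorph_prod /= [RHS](reindex_inj (addIr j)) /=; apply: eq_bigr => k _.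
  rewrite rmorphB /= map_polyX map_polyC /= /shift -comp_polyA rmorphD /=.
  by rewrite comp_polyX comp_polyC rD polyCD addrA addrAC.
(* The boolean equality lets [xchoose] produce the polynomials as a function of i. *)
have cP i : exists Q, P`_i == Q \Po shift_norm.
  by have [Q ->] := shift_invariantP (invP^~ i); exists Q.
exists (fun i => xchoose (cP i)).
have szP : size P = #|J|.+1 by rewrite /P size_prod_XsubC /index_enum -enumT -cardE.
have lcP : P`_#|J| = 1.
  by have /monicP := monic_prod_XsubC (index_enum J) predT (fun j => shift j q); rewrite lead_coefE szP.
rewrite -[LHS]coefK poly_def szP big_ord_recr /= lcP scale1r addrC; congr (_ + _).
by apply: eq_bigr => i _; rewrite -(eqP (xchooseP (cP i))).
Qed.

End ShiftInvariants.

(** * Two independent groups of translations *)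

Section DoubleShift.
Variables (R : idomainType) (J K : finZmodType).
Variables (r : J -> R) (s : K -> R).
Hypotheses (rD : {morph r : i j / i + j}) (sD : {morph s : i j / i + j}).
Hypotheses (r_inj : injective r) (s_inj : injective s).

(** The invariants of independent translations of two variables are generated over R by the two
    norms; G stands for membership in a subalgebra. The one-variable result is applied first to the
    outer variable, then to each coefficient of the result. *)
Lemma double_shift_ind (G : {poly {poly R}} -> Prop) (h : {poly {poly R}}) :
    (forall c, G c%:P%:P) -> (forall h1 h2, G h1 -> G h2 -> G (h1 + h2)) ->
    (forall h1 h2, G h1 -> G h2 -> G (h1 * h2)) ->
    G (shift_norm r)%:P -> G (map_poly polyC (shift_norm s)) ->
    (forall j, map_poly (comp_poly ('X + (r j)%:P)) h = h) ->
    (forall k, h \Po ('X + (s k)%:P%:P) = h) ->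
  G h.
Proof.
move=> GC GD GM Gr Gs invr invs.
pose s' k := (s k)%:P.
have s'D : {morph s' : i j / i + j} by move=> i j; rewrite /s' sD polyCD.
have s'_inj : injective s' by move=> k1 k2 /polyC_inj/s_inj.
have normE : shift_norm s' = map_poly polyC (shift_norm s).
  rewrite rmorph_prod; apply: eq_bigr => k _.
  by rewrite rmorphB /= map_polyX map_polyC.
have [Q defh] := shift_invariantP s'D s'_inj invs.
have [Gsum GXn] : (forall (I : Type) (t : seq I) E, (forall i, G (E i)) -> G (\sum_(i <- t) E i))
    /\ (forall h1 n, G h1 -> G (h1 ^+ n)).
  split=> [I t E GE|h1 n Gh1].
    by elim/big_ind: _ => //; rewrite -!polyC0; apply: GC.
  by elim: n => [|n IHn]; rewrite ?expr0 -?polyC1 // exprS; apply: GM.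
(* Translating the inner variable fixes h and the outer norm. Since Q is determined by h, it is
   fixed as well. *)
have invQ j : map_poly (comp_poly ('X + (r j)%:P)) Q = Q.
  apply: (comp_shift_norm_inj (r := s')); rewrite -defh -[RHS](invr j) defh.
  rewrite map_comp_poly; congr (_ \Po _); rewrite normE -map_poly_comp.
  by apply: eq_map_poly => c /=; rewrite comp_polyC.
rewrite defh comp_polyE; apply: (Gsum) => i; rewrite -mul_polyC.
apply: (GM); last by apply: (GXn); rewrite normE.
have [j|q ->] := @shift_invariantP _ _ r rD r_inj Q`_i.
  by have := congr1 (fun P : {poly _} => P`_i) (invQ j); rewrite coef_map.
rewrite comp_polyE rmorph_sum; apply: (Gsum) => l /=.
by rewrite -mul_polyC polyCM polyC_exp; apply: (GM) => //; apply: (GXn).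
Qed.

End DoubleShift.

(** * The prime field and its additive polynomials *)

Section PrimeField.
Variables (p : nat) (R : idomainType).
Hypothesis charR : p \in [pchar R].

Definition Fp_in (j : 'F_p) : R := (j : nat)%:R.

Let p_prime : prime p. Proof. by case/andP: charR. Qed.

Lemma Fp_inD : {morph Fp_in : i j / i + j}.
Proof.
move=> i j; rewrite /Fp_in -natrD.
have -> : (i + j : 'F_p) = ((i + j) %% p)%N :> nat by rewrite /= [X in (_ %% X)%N]Fp_cast.
exact: GRing.natr_mod_pchar.
Qed.

Lemma Fp_in0 : Fp_in 0 = 0. Proof. by []. Qed.

Lemma Fp_inN : {morph Fp_in : i / - i}.
Proof. by move=> i; apply/eqP; rewrite -addr_eq0 -Fp_inD addNr. Qed.

Lemma Fp_in_eq0 j : (Fp_in j == 0) = (j == 0).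
Proof.
rewrite /Fp_in -(dvdn_pcharf charR); apply/idP/eqP => [|-> //].
have ltj : (j < p)%N by rewrite -[X in (_ < X)%N](Fp_cast p_prime) ltn_ord.
by case: (posnP j) => [j0 _|j0 /(dvdn_leq j0)]; [apply/val_inj | rewrite leqNgt ltj].
Qed.

Lemma Fp_in_inj : injective Fp_in.
Proof.
move=> i j /eqP; rewrite -subr_eq0 -Fp_inN -Fp_inD Fp_in_eq0 subr_eq0.
by move/eqP.
Qed.

Lemma Fp_in_exp j : Fp_in j ^+ p = Fp_in j.
Proof. by rewrite -(pFrobenius_autE charR) /Fp_in pFrobenius_aut_nat. Qed.

(** Both sides are monic of degree p in X, and for nonzero c the right side vanishes at the p
    distinct points j c. *)
Lemma prod_Fp (X c : R) :
  \prod_(j : 'F_p) (X - Fp_in j * c) = X ^+ p - c ^+ p.-1 * X.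
Proof.
have p_gt1 := prime_gt1 p_prime; have cardFp : #|'F_p| = p by apply: card_Fp.
(* For c = 0 the points j c coincide, and both sides are X^p. *)
have [->|c0] := eqVneq c 0.
  rewrite expr0n eqn0Ngt -subn1 subn_gt0 p_gt1 mul0r subr0.
  by under eq_bigr do rewrite mulr0 subr0; rewrite prodr_const cardFp.
pose P : {poly R} := 'X^p - c ^+ p.-1 *: 'X.
have szcX : (size (- (c ^+ p.-1 *: 'X) : {poly R}) < size ('X^p : {poly R}))%N.
  by rewrite size_polyN size_polyXn (leq_ltn_trans (size_scale_leq _ _)) // size_polyX.
have szP : size P = p.+1 by rewrite size_polyDl // size_polyXn.
have lcP : lead_coef P = 1 by rewrite lead_coefDl // lead_coefXn.
have [||Q defP] := @prod_XsubC_dvd _ P [seq Fp_in j * c | j : 'F_p].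
- by rewrite map_inj_uniq ?enum_uniq // => i j /(mulIf c0); apply: Fp_in_inj.
- apply/allP => _ /mapP[j _ ->]; rewrite rootE hornerD hornerN hornerZ hornerXn hornerX exprMn Fp_in_exp.
  by rewrite mulrCA -exprSr prednK ?subrr // prime_gt0.
have szQ : size Q = 1%N.
  have := szP; rewrite defP size_Mmonic ?monic_prod_XsubC //; last first.
    by apply/eqP => Q0; have := szP; rewrite defP Q0 mul0r size_poly0.
  rewrite size_prod_XsubC size_map -cardE cardFp; move: (size _) => q; lia.
have := lcP; rewrite defP lead_coef_Mmonic ?monic_prod_XsubC //.
rewrite (size1_polyC (eq_leq szQ)) lead_coefC => Q1.
move: defP; rewrite (size1_polyC (eq_leq szQ)) Q1 mul1r big_map big_enum /=.
move/(congr1 (horner_eval X)); rewrite rmorph_prod /= /horner_eval /P.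
rewrite hornerD hornerN hornerZ hornerXn hornerX => ->; apply: eq_bigr => j _.
by rewrite hornerXsubC.
Qed.

Lemma exprD_p (X Y : R) : (X + Y) ^+ p = X ^+ p + Y ^+ p.
Proof. by rewrite exprDn_pchar // pnatE. Qed.

Lemma exprN_p (X : R) : (- X) ^+ p = - X ^+ p.
Proof. by rewrite exprNn_pchar // pnatE. Qed.

Lemma exprB_p (X Y : R) : (X - Y) ^+ p = X ^+ p - Y ^+ p.
Proof. by rewrite exprD_p exprN_p. Qed.

End PrimeField.

(** For fixed j the product over k is W(X - j a v), where W is the additive polynomial of the line
    spanned by b v. By additivity the product over j is of the same kind with W(a v) in place of a
    v, so [prod_Fp] applies twice. *)
Lemma prod_Fp_plane (p : nat) (F : fieldType) (R : idomainType) (f : {rmorphism F -> R})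
    (charF : p \in [pchar F]) (a b : F) :
  exists A B : F, forall X v : R,
    \prod_(jk : 'F_p * 'F_p) (X - f (Fp_in F jk.1 * a + Fp_in F jk.2 * b) * v) =
    X ^+ (p ^ 2) + f A * X ^+ p * v ^+ (p * p.-1) + f B * X * v ^+ (p ^ 2 - 1).
Proof.
have charR : p \in [pchar R] by rewrite (fmorph_pchar f).
have p_gt0 : (0 < p)%N by case/andP: charF => /prime_gt0.
pose d := a ^+ p - b ^+ p.-1 * a.
(* Read off from (W X)^p - (d v^p)^(p-1) W X, where d v^p is the value of W at a v. *)
exists (- (b ^+ (p * p.-1) + d ^+ p.-1)), (d ^+ p.-1 * b ^+ p.-1) => X v.
pose W Z : R := Z ^+ p - (f b * v) ^+ p.-1 * Z.
have WB Z (j : 'F_p) Y : W (Z - Fp_in R j * Y) = W Z - Fp_in R j * W Y.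
  rewrite /W (exprB_p charR) [(_ * Y) ^+ p]exprMn (Fp_in_exp charR); ring.
have fFp (j : 'F_p) : f (Fp_in F j) = Fp_in R j by rewrite /Fp_in rmorph_nat.
rewrite -(pair_bigA _ (fun j k => X - f (Fp_in F j * a + Fp_in F k * b) * v)) /=.
transitivity (\prod_(j : 'F_p) (W X - Fp_in R j * W (f a * v))).
  apply: eq_bigr => j _; rewrite -WB /W -(prod_Fp charR); apply: eq_bigr => k _.
  rewrite rmorphD !rmorphM /= !fFp; ring.
rewrite (prod_Fp charR).
have -> : W (f a * v) = f d * v ^+ p.
  rewrite /W /d rmorphB rmorphM !rmorphXn /= -[in v ^+ p](prednK p_gt0) exprS !exprMn.
  rewrite -{2}(prednK p_gt0) exprS; ring.
clearbody d; rewrite /W (exprB_p charR) !rmorphN rmorphD rmorphM !rmorphXn /=.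
have -> : (p ^ 2 - 1 = p * p.-1 + p.-1)%N by nia.
rewrite expnS expn1 !exprM exprD exprM !exprMn -!exprM [(p.-1 * p)%N]mulnC.
ring.
Qed.

(** * The group action and orbit products *)

(** Pairs over ['F_p] serve below as a finite abelian group indexing U. *)
HB.saturate prod.

Lemma mpoly_rmorph_eq (n : nat) (F : fieldType) (S : comNzRingType)
    (f g : {rmorphism {mpoly F[n]} -> S}) :
  (forall c, f c%:MP = g c%:MP) -> (forall i, f 'X_i = g 'X_i) -> f =1 g.
Proof.
move=> eqC eqX P; rewrite (mpolyE P) !rmorph_sum; apply: eq_bigr => m _ /=.
rewrite -mul_mpolyC !rmorphM /= eqC mpolyXE_id !rmorph_prod; congr (_ * _).
by apply: eq_bigr => i _; rewrite !rmorphXn /= eqX.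
Qed.

Lemma ord3P (P : 'I_3 -> Prop) : P 0 -> P 1 -> P 2 -> forall i, P i.
Proof.
move=> P0 P1 P2 [[|[|[|//]]] lti].
- by rewrite (_ : Ordinal lti = 0) //; apply/val_inj.
- by rewrite (_ : Ordinal lti = 1) //; apply/val_inj.
- by rewrite (_ : Ordinal lti = 2) //; apply/val_inj.
Qed.

Section Action.
Variables (F : fieldType).
Implicit Types (t s : F) (f : {mpoly F[3]}).

(** The generator e_i is the case t = c_1i, s = c_2i. These maps compose by adding the pairs (t, s),
    so G acts through an additive subgroup of F^2. *)
Definition transl t s f : {mpoly F[3]} :=
  f \mPo [tuple x; y + t *: x; z + (2 * t) *: y + (t ^+ 2 + s) *: x].

Lemma transl_x t s : transl t s x = x.
Proof. by rewrite /transl comp_mpolyXU. Qed.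
Lemma transl_y t s : transl t s y = y + t *: x.
Proof. by rewrite /transl comp_mpolyXU. Qed.
Lemma transl_z t s : transl t s z = z + (2 * t) *: y + (t ^+ 2 + s) *: x.
Proof. by rewrite /transl comp_mpolyXU. Qed.

Definition translE := (transl_x, transl_y, transl_z).

HB.instance Definition _ t s := GRing.RMorphism.copy (transl t s) (transl t s).

Lemma translC t s c : transl t s c%:MP = c%:MP.
Proof. exact: comp_mpolyC. Qed.

Lemma translZ t s c f : transl t s (c *: f) = c *: transl t s f.
Proof. exact: comp_mpolyZ. Qed.

Lemma rmorph_xyz_eq (S : comNzRingType) (f g : {rmorphism {mpoly F[3]} -> S}) :
  (forall c, f c%:MP = g c%:MP) -> f x = g x -> f y = g y -> f z = g z -> f =1 g.
Proof. by move=> eqC eqx eqy eqz; apply: mpoly_rmorph_eq => //; apply: ord3P. Qed.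

Lemma transl_transl t1 s1 t2 s2 f :
  transl t1 s1 (transl t2 s2 f) = transl (t1 + t2) (s1 + s2) f.
Proof.
apply: (rmorph_xyz_eq (f := transl t1 s1 \o transl t2 s2)
  (g := transl (t1 + t2) (s1 + s2))) => [c|||] /=; rewrite ?translC ?translE //.
  by rewrite rmorphD /= translZ !translE -addrA -scalerDl.
rewrite !rmorphD /= !translZ !translE -!mul_mpolyC !(rmorphD, rmorphM, rmorphXn, rmorph_nat) /=.
ring.
Qed.

Lemma transl0 f : transl 0 0 f = f.
Proof.
apply: (rmorph_xyz_eq (f := transl 0 0) (g := idfun)) => [c|||] /=;
  by rewrite ?translC ?translE ?mulr0 ?expr0n ?addr0 ?scale0r ?addr0.
Qed.

Lemma iter_transl k t s f : iter k (transl t s) f = transl (k%:R * t) (k%:R * s) f.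
Proof.
elim: k => [|k IHk]; first by rewrite !mul0r transl0.
by rewrite iterS IHk transl_transl -!nat1r !mulrDl !mul1r.
Qed.

End Action.

Section Group.
Variables (p : nat) (F : fieldType) (c12 c22 c23 : F).
Hypotheses (charF : p \in [pchar F]) (p_gt2 : (2 < p)%N).
Let M := normal_form c12 c22 c23.
Local Notation iota := (@Fp_in p F).

Definition translU (jk : 'F_p * 'F_p) : F := iota jk.1 * c22 + iota jk.2 * c23.
Definition translT (a : 'rV['F_p]_3) : F := iota (a 0 0) + iota (a 0 1) * c12.

Lemma actE a f : act M a f = transl (translT a) (translU (a 0 1, a 0 2)) f.
Proof.
rewrite /act -!/(transl _ _); pose tr := @transl F.
have iterE k i h : iter k (act_gen M i) h = tr (k%:R * M 0 i) (k%:R * M 1 i) h.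
  exact: iter_transl.
rewrite !iterE /tr !transl_transl /M !mxE /= /translT /translU /Fp_in /=.
rewrite !(mulr0, mulr1, addr0, add0r).
by rewrite [X in transl X]addrC [X in transl _ X]addrC.
Qed.

Lemma translT_add : {morph translT : a b / a + b}.
Proof. by move=> a b; rewrite /translT !mxE !(Fp_inD charF) mulrDl addrACA. Qed.

Lemma translU_add : {morph translU : i j / i + j}.
Proof. by move=> i j; rewrite /translU !(Fp_inD charF) !mulrDl addrACA. Qed.

Lemma act_add (a b : 'rV['F_p]_3) f : act M a (act M b f) = act M (a + b) f.
Proof.
by rewrite !actE transl_transl -translU_add -translT_add !mxE.
Qed.

Lemma act0 f : act M (0 : 'rV['F_p]_3) f = f.
Proof.
rewrite actE /translT /translU !mxE /= Fp_in0 !mul0r !addr0; exact: transl0.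
Qed.

Lemma act_inj (a : 'rV['F_p]_3) : injective (act M a).
Proof.
by move=> f g eq_fg; rewrite -[f]act0 -[g]act0 -(addNr a) -!act_add eq_fg.
Qed.

Lemma act_orbit_prod (a : 'rV['F_p]_3) f : act M a (orbit_prod p M f) = orbit_prod p M f.
Proof.
rewrite actE /orbit_prod rmorph_prod /=.
under eq_bigr => h _ do rewrite -actE.
rewrite -(big_map (act M a) xpredT id) /=; apply: perm_big.
apply: uniq_perm; rewrite ?map_inj_uniq ?undup_uniq //; first exact: act_inj.
move=> h; rewrite mem_undup; apply/mapP/mapP => [[_ /[!mem_undup]/mapP[b _ ->] ->]|[b _ ->]].
  by exists (a + b); rewrite ?mem_enum // act_add.
exists (act M (b - a) f); last by rewrite act_add addrC subrK.
by rewrite mem_undup; apply/mapP; exists (b - a); rewrite ?mem_enum.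
Qed.

Lemma orbit_prodE (J : finType) (h : J -> {mpoly F[3]}) f :
  injective h -> (forall a : 'rV['F_p]_3, exists j, act M a f = h j) ->
  (forall j, exists a : 'rV['F_p]_3, act M a f = h j) -> orbit_prod p M f = \prod_j h j.
Proof.
move=> h_inj act_h h_act; rewrite -(big_map h xpredT id) /=; apply: perm_big.
apply: uniq_perm; rewrite ?undup_uniq ?map_inj_uniq ?index_enum_uniq //.
move=> g; rewrite mem_undup; apply/mapP/mapP => [[a _ ->]|[j _ ->]].
  by have [j ->] := act_h a; exists j; rewrite ?mem_index_enum.
by have [a <-] := h_act j; exists a; rewrite ?mem_enum.
Qed.

(** At c the polynomial X^p - X vanishes and splits into the factors c - i, so one of these is
    zero. *)
Lemma Fp_in_fixed (c : F) : c ^+ p = c -> exists i, c = iota i.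
Proof.
move=> cp; have := prod_Fp charF c 1; rewrite expr1n mul1r cp subrr => /eqP.
case/prodf_eq0 => i _; rewrite mulr1 subr_eq0 => /eqP ->.
by exists i.
Qed.

Hypotheses (c12_Fp : c12 ^+ p = c12) (translU_inj : injective translU).

Lemma translT_Fp a : exists i, translT a = iota i.
Proof.
apply: Fp_in_fixed; rewrite /translT (exprD_p charF) exprMn c12_Fp !(Fp_in_exp charF) //.
Qed.

(** The exponents of e_2 and e_3 determine the part in U. As e_1 changes t alone and c12 lies in
    F_p, t can then be given any value in F_p. *)
Lemma translT_surj i jk : exists a : 'rV['F_p]_3, translT a = iota i /\ (a 0 1, a 0 2) = jk.
Proof.
have [|l c12l] := @Fp_in_fixed (iota jk.1 * c12).
  by rewrite exprMn c12_Fp (Fp_in_exp charF).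
exists (\row_k nth 0 [:: i - l; jk.1; jk.2] k); rewrite /translT !mxE /= c12l.
by rewrite -(Fp_inD charF) subrK; case: (jk).
Qed.

Definition U_inv f := forall i jk, transl (iota i) (translU jk) f = f.

Lemma G_invariantP f : G_invariant p M f <-> U_inv f.
Proof.
split=> [inv i jk|inv a].
  by have [a [<- <-]] := translT_surj i jk; rewrite -actE.
by have [i Ti] := translT_Fp a; rewrite actE Ti.
Qed.

Lemma orbit_prod_transl (J : finType) (h : J -> {mpoly F[3]}) f
    (k : 'F_p -> 'F_p * 'F_p -> J) :
  injective h -> (forall i jk, transl (iota i) (translU jk) f = h (k i jk)) ->
  (forall j, exists i jk, k i jk = j) -> orbit_prod p M f = \prod_j h j.
Proof.
move=> h_inj trh k_surj; apply: orbit_prodE => // [a|j].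
  by have [i Ti] := translT_Fp a; exists (k i (a 0 1, a 0 2)); rewrite actE Ti.
have [i [jk <-]] := k_surj j; have [a [Ta Ua]] := translT_surj i jk.
by exists a; rewrite actE Ta Ua.
Qed.

Lemma scale_x_inj : injective (fun c : F => c *: (x : {mpoly F[3]})).
Proof.
move=> c d /(congr1 (mcoeff U_(0))); rewrite !mcoeffZ mcoeffX eqxx !mulr1.
by [].
Qed.

Lemma orbit_y : orbit_prod p M (@y F) = \prod_(i : 'F_p) (y - iota i *: x).
Proof.
rewrite (@orbit_prod_transl _ (fun i => y + iota i *: x) _ (fun i _ => i)).
- rewrite (reindex_inj oppr_inj) /=; apply: eq_bigr => i _.
  by rewrite (Fp_inN charF) scaleNr.
- by move=> i j /addrI/scale_x_inj/(Fp_in_inj charF).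
- by move=> i jk; rewrite translE.
- by move=> i; exists i, (0, 0).
Qed.

Lemma transl_delta (t s : F) : transl t s delta = delta - s *: x ^+ 2.
Proof.
rewrite /delta rmorphB rmorphXn rmorphM /= !translE -!mul_mpolyC.
rewrite !(rmorphD, rmorphM, rmorphXn, rmorph_nat) /=; ring.
Qed.

Lemma orbit_delta : orbit_prod p M (@delta F) = \prod_jk (delta - translU jk *: x ^+ 2).
Proof.
apply: (@orbit_prod_transl _ (fun jk => @delta F - translU jk *: x ^+ 2) _ (fun _ jk => jk)).
- move=> i j /addrI/oppr_inj/(congr1 (mcoeff (U_(0) *+ 2))).
  rewrite !mcoeffZ /x mpolyXn mcoeffX eqxx !mulr1.
  exact: translU_inj.
- by move=> i jk; rewrite transl_delta.
- by move=> jk; exists 0, jk.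
Qed.

(** The conjugates of z with a fixed t. Over all t in F_p they make up N(z); the case t = 0 is the
    part of g that involves z. *)
Definition zconj (t : F) : {mpoly F[3]} :=
  \prod_jk (z + (2 * t) *: y + (t ^+ 2 + translU jk) *: x).

Lemma two_neq0 : 2 != 0 :> F.
Proof.
by rewrite -(dvdn_pcharf charF); apply/negP => /(dvdn_leq (isT : (0 < 2)%N)); rewrite leqNgt p_gt2.
Qed.

Lemma orbit_z : orbit_prod p M (@z F) = \prod_(i : 'F_p) zconj (iota i).
Proof.
rewrite /zconj pair_bigA /=.
apply: (@orbit_prod_transl _ (fun q => z + (2 * iota q.1) *: y +
   (iota q.1 ^+ 2 + translU q.2) *: x) _ (fun i jk => (i, jk))).
- move=> [i1 jk1] [i2 jk2] /= eq12.
  (* The coefficient of y is 2t, which separates the values of t because p is odd. *)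
  have c1 : (i1 : 'F_p) = i2.
    move: eq12 => /(congr1 (mcoeff U_(1))).
    rewrite !mcoeffD !mcoeffZ !mcoeffX !eq_mnm1 /= !mulr1 !mulr0 !addr0 !add0r.
    by move/(mulfI two_neq0)/(Fp_in_inj charF).
  move: eq12; rewrite c1 => /addrI/scale_x_inj/addrI/translU_inj ->.
  by [].
- by move=> i jk; rewrite translE.
- by move=> [i jk]; exists i, jk.
Qed.

End Group.

(** * The generator g *)

Section Bieval.
Variables (F : fieldType) (S : comNzRingType) (f : {rmorphism F -> S}) (a b : S).

(** The inner variable goes to a and the outer one to b; in the applications they stand for x and y
    or N(y). *)
Definition bieval (q : {poly {poly F}}) : S :=
  (horner_eval b \o map_poly (horner_eval a \o map_poly f)) q.

HB.instance Definition _ := GRing.RMorphism.copy bieval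
  (horner_eval b \o map_poly (horner_eval a \o map_poly f)).

Lemma bievalC c : bieval c%:P = (map_poly f c).[a].
Proof. by rewrite /bieval /= map_polyC /horner_eval hornerC. Qed.

Lemma bieval_const c : bieval c%:P%:P = f c.
Proof. by rewrite bievalC map_polyC hornerC. Qed.

Lemma bieval_x : bieval 'X%:P = a.
Proof. by rewrite bievalC map_polyX hornerX. Qed.

Lemma bieval_y : bieval 'X = b.
Proof. by rewrite /bieval /= map_polyX /horner_eval hornerX. Qed.

End Bieval.

Lemma bieval_ind (F : fieldType) (G : {poly {poly F}} -> Prop) :
    (forall c, G c%:P%:P) -> G 'X%:P -> G 'X ->
    (forall q1 q2, G q1 -> G q2 -> G (q1 + q2)) ->
    (forall q1 q2, G q1 -> G q2 -> G (q1 * q2)) ->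
  forall q, G q.
Proof.
move=> Gc Gx Gy GD GM; elim/poly_ind => [|q c IHq]; first by rewrite -!polyC0.
apply: (GD) => //; first exact: (GM).
elim/poly_ind: c => [|c d IHc]; first by rewrite -!polyC0.
by rewrite polyCD polyCM; apply: (GD) => //; apply: (GM).
Qed.

Lemma rmorph_bieval (F : fieldType) (S S' : comNzRingType) (f : {rmorphism F -> S})
    (f' : {rmorphism F -> S'}) (g : {rmorphism S -> S'}) a b q :
  g \o f =1 f' -> g (bieval f a b q) = bieval f' (g a) (g b) q.
Proof.
move=> eqf; elim/bieval_ind: q => [c|||q1 q2 IH1 IH2|q1 q2 IH1 IH2].
- by rewrite !bieval_const -eqf.
- by rewrite !bieval_x.
- by rewrite !bieval_y.
- by rewrite !rmorphD IH1 IH2.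
- by rewrite !rmorphM IH1 IH2.
Qed.

Lemma bieval_comp (F : fieldType) (S : comNzRingType) (f : {rmorphism F -> S}) a b q r :
  bieval f a b (q \Po r) = bieval f a (bieval f a b r) q.
Proof.
elim/bieval_ind: q => [c|||q1 q2 IH1 IH2|q1 q2 IH1 IH2].
- by rewrite comp_polyC !bieval_const.
- by rewrite comp_polyC !bieval_x.
- by rewrite comp_polyX !bieval_y.
- by rewrite comp_polyD !rmorphD /= IH1 IH2.
- by rewrite comp_polyM !rmorphM /= IH1 IH2.
Qed.

(** Frobenius distributes the p-th powers. The terms y^(2p^2) of N(delta) and N(y)^(2p) cancel, and
    the correction 2 N(y)^(p+1) x^(p(p-1)) removes y^(p^2+p); all that is left is divisible by
    x^(p^2-1). *)
Lemma gtilde_div (p : nat) (R : idomainType) (charR : p \in [pchar R]) (x y z a b : R) :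
  x ^+ (p ^ 2 - 1) * (2 * y ^+ (p ^ 2 + 1) + (1 + a) * x ^+ (p.-1 ^ 2) * y ^+ (2 * p)
      - 2 * x ^+ (p * p.-1) * y ^+ p.+1 + b * x ^+ (p ^ 2 - 1) * y ^+ 2
      - x * (z ^+ (p ^ 2) + a * z ^+ p * x ^+ (p * p.-1) + b * z * x ^+ (p ^ 2 - 1))) =
  (y ^+ 2 - x * z) ^+ (p ^ 2) + a * (y ^+ 2 - x * z) ^+ p * (x ^+ 2) ^+ (p * p.-1)
  + b * (y ^+ 2 - x * z) * (x ^+ 2) ^+ (p ^ 2 - 1)
  - (y ^+ p - x ^+ p.-1 * y) ^+ (2 * p)
  - 2 * (y ^+ p - x ^+ p.-1 * y) ^+ p.+1 * x ^+ (p * p.-1).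
Proof.
have p_gt0 : (0 < p)%N by case/andP: charR => /prime_gt0.
have pE : (p = p.-1.+1)%N by rewrite prednK.
rewrite subn1; pose u := x ^+ p.-1; pose w := x ^+ (p.-1 ^ 2).
have x_p : x ^+ p = x * u by rewrite {1}pE exprS.
have x_pp : x ^+ (p * p.-1) = u * w by rewrite -exprD; congr (_ ^+ _); nia.
have x_p2 : x ^+ (p ^ 2).-1 = u * u * w by rewrite -!exprD; congr (_ ^+ _); nia.
have u_p : u ^+ p = u * w by rewrite -exprM mulnC.
have sq (h : R) : h ^+ (p ^ 2) = (h ^+ p) ^+ p by rewrite expnS expn1 exprM.
have deltap : (y ^+ 2 - x * z) ^+ p = (y ^+ p) ^+ 2 - x * u * z ^+ p.
  by rewrite (exprB_p charR) exprAC [(x * z) ^+ p]exprMn x_p.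
have deltap2 : (y ^+ 2 - x * z) ^+ (p ^ 2) =
    ((y ^+ p) ^+ p) ^+ 2 - x * (u * u * w) * (z ^+ p) ^+ p.
  rewrite sq deltap (exprB_p charR) [((y ^+ p) ^+ 2) ^+ p]exprAC !exprMn x_p u_p.
  by rewrite !mulrA.
have Np : (y ^+ p - u * y) ^+ p = (y ^+ p) ^+ p - u * w * y ^+ p.
  by rewrite (exprB_p charR) exprMn u_p.
have xx n : (x ^+ 2) ^+ n = (x ^+ n) ^+ 2 by rewrite exprAC.
rewrite [(2 * p)%N]mulnC !(exprM _ p 2) (exprS (_ - _)) -/u Np !xx x_pp x_p2 deltap deltap2 -/w.
rewrite addn1 !exprS !sq.
ring.
Qed.

Section Generator.
Variables (p : nat) (F : fieldType) (c12 c22 c23 : F).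
Hypotheses (charF : p \in [pchar F]) (p_gt2 : (2 < p)%N).
Hypotheses (c12_Fp : c12 ^+ p = c12) (translU_inj : injective (@translU p F c22 c23)).
Let M := normal_form c12 c22 c23.
Local Notation iota := (@Fp_in p F).
Local Notation U := (@translU p F c22 c23).
Local Notation mC := (@mpolyC 3 F).
Variables (A B : F).
Hypothesis planeE : forall X v : {mpoly F[3]}, \prod_jk (X - (U jk)%:MP * v) =
    X ^+ (p ^ 2) + A%:MP * X ^+ p * v ^+ (p * p.-1) + B%:MP * X * v ^+ (p ^ 2 - 1).

Let charR : p \in [pchar {mpoly F[3]}]. Proof. by rewrite (fmorph_pchar mC). Qed.

(* The quotient by x^(p^2-1) of the part of gtilde that does not involve z. *)
Definition g_xy : {poly {poly F}} :=
  2 * 'X ^+ (p ^ 2 + 1) + (1 + A)%:P%:P * 'X%:P ^+ (p.-1 ^ 2) * 'X ^+ (2 * p)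
  - 2 * 'X%:P ^+ (p * p.-1) * 'X ^+ p.+1 + B%:P%:P * 'X%:P ^+ (p ^ 2 - 1) * 'X ^+ 2.

(** The generator g as an explicit polynomial, with no division by a power of x; [sagbi_gE] links it
    to [gtilde]. *)
Definition sagbi_g : {mpoly F[3]} := 2^-1 *: (bieval mC x y g_xy - x * zconj p c22 c23 0).

Lemma sagbi_g_double : 2 * sagbi_g = bieval mC x y g_xy - x * zconj p c22 c23 0.
Proof.
rewrite /sagbi_g -mul_mpolyC mulrA -[2](rmorph_nat mC) -mpolyCM mulfV ?mul1r //.
exact: two_neq0 charF p_gt2.
Qed.

Lemma orbit_yE : orbit_prod p M (@y F) = y ^+ p - x ^+ p.-1 * y.
Proof.
rewrite (orbit_y c22 c23 charF c12_Fp) -(prod_Fp charR); apply: eq_bigr => i _.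
by rewrite -mul_mpolyC /Fp_in rmorph_nat.
Qed.

Lemma bieval_g_xy : bieval mC x y g_xy =
  2 * y ^+ (p ^ 2 + 1) + (1 + A)%:MP * x ^+ (p.-1 ^ 2) * y ^+ (2 * p)
  - 2 * x ^+ (p * p.-1) * y ^+ p.+1 + B%:MP * x ^+ (p ^ 2 - 1) * y ^+ 2.
Proof.
have bXn := rmorphXn (bieval mC x y); have bM := rmorphM (bieval mC x y).
rewrite /g_xy rmorphD rmorphB rmorphD !bM !bXn rmorph_nat /=.
by rewrite !bieval_const !bieval_x !bieval_y.
Qed.

Lemma zconj0E : zconj p c22 c23 0 = z ^+ (p ^ 2) + A%:MP * z ^+ p * x ^+ (p * p.-1) +
  B%:MP * z * x ^+ (p ^ 2 - 1) :> {mpoly F[3]}.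
Proof.
(* U is stable under negation, which turns the factors z + s x into the z - s x of [planeE]. *)
rewrite -planeE /zconj (reindex_inj oppr_inj) /=; apply: eq_bigr => jk _.
rewrite mulr0 scale0r addr0 expr0n add0r -mul_mpolyC -mulNr; congr (_ + _ * _).
rewrite -mpolyCN; congr mpolyC; apply/eqP.
by rewrite -addr_eq0 -translU_add // addNr /translU /= Fp_in0 !mul0r addr0.
Qed.

Lemma sagbi_gE : 2 * x ^+ (p ^ 2 - 1) * sagbi_g = gtilde p M.
Proof.
rewrite mulrAC sagbi_g_double bieval_g_xy zconj0E /gtilde.
have -> : orbit_prod p M (@delta F) = \prod_jk (delta - (U jk)%:MP * x ^+ 2).
  by rewrite orbit_delta //; apply: eq_bigr => jk _; rewrite -mul_mpolyC.
by rewrite planeE orbit_yE [(p - 1)%N]subn1 mulrC mpolyCD; apply: gtilde_div.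
Qed.

End Generator.

Lemma bieval_XaddC (F : fieldType) (S : comNzRingType) (f : {rmorphism F -> S}) a b c :
  bieval f a b ('X + (c *: 'X)%:P) = b + f c * a.
Proof.
by rewrite rmorphD /= bieval_y bievalC map_polyZ map_polyX hornerZ hornerX.
Qed.

(** * Invariance of g, the relation for g^p, and the lead terms of the generators *)

Section GeneratorInvariance.
Variables (p : nat) (F : fieldType) (c12 c22 c23 : F).
Hypotheses (charF : p \in [pchar F]) (p_gt2 : (2 < p)%N).
Hypotheses (c12_Fp : c12 ^+ p = c12) (translU_inj : injective (@translU p F c22 c23)).
Let M := normal_form c12 c22 c23.
Local Notation iota := (@Fp_in p F).
Local Notation U := (@translU p F c22 c23).
Local Notation mC := (@mpolyC 3 F).
Variables (A B : F).
Hypothesis planeE : forall X v : {mpoly F[3]}, \prod_jk (X - (U jk)%:MP * v) =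
    X ^+ (p ^ 2) + A%:MP * X ^+ p * v ^+ (p * p.-1) + B%:MP * X * v ^+ (p ^ 2 - 1).

Local Notation g := (sagbi_g p c22 c23 A B).
Local Notation g_xy := (g_xy p A B).
Local Notation Ny := (orbit_prod p M (@y F)).
Local Notation Nz := (orbit_prod p M (@z F)).

Lemma x_neq0 : x != 0 :> {mpoly F[3]}.
Proof. by apply/eqP => /(congr1 (mcoeff U_(0)))/eqP; rewrite mcoeffX eqxx mcoeff0 oner_eq0. Qed.

Lemma two_mpoly_neq0 : 2 != 0 :> {mpoly F[3]}.
Proof. by rewrite -(rmorph_nat mC) mpolyC_eq0; apply: two_neq0 charF p_gt2. Qed.

Lemma orbit_prod_inv f : G_invariant p M (orbit_prod p M f).
Proof. by move=> a; apply: act_orbit_prod. Qed.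

Lemma x_inv : G_invariant p M x.
Proof. by move=> a; rewrite actE transl_x. Qed.

(** The polynomial [gtilde] is built from orbit products and x, hence invariant, and the invariant
    factor 2 x^(p^2-1) can be cancelled. *)
Lemma sagbi_g_inv : G_invariant p M g.
Proof.
move=> a; have k0 : 2 * x ^+ (p ^ 2 - 1) != 0 :> {mpoly F[3]}.
  by rewrite mulf_neq0 ?two_mpoly_neq0 // expf_neq0 // x_neq0.
apply: (mulfI k0); rewrite (sagbi_gE charF p_gt2 c12_Fp translU_inj planeE).
have -> : 2 * x ^+ (p ^ 2 - 1) * act M a g = act M a (gtilde p M).
  rewrite -(sagbi_gE charF p_gt2 c12_Fp translU_inj planeE) !actE !rmorphM rmorphXn /= rmorph_nat.
  by rewrite transl_x.
rewrite /gtilde actE 2!rmorphB rmorphM /= rmorphXn rmorphM rmorph_nat !rmorphXn /=.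
by rewrite transl_x -!actE !act_orbit_prod.
Qed.

Lemma translU0 : U 0 = 0.
Proof. by rewrite /translU /= Fp_in0 !mul0r addr0. Qed.

Lemma transl_zconj0 t : transl t 0 (zconj p c22 c23 0) = zconj p c22 c23 t.
Proof.
rewrite /zconj rmorph_prod; apply: eq_bigr => jk _.
rewrite mulr0 scale0r addr0 expr0n /= add0r rmorphD /= translZ transl_z transl_x.
by rewrite addr0 scalerDl addrA.
Qed.

(** In F[x][y] the map y -> y + i x is the translation by this constant. *)
Definition xshift (i : 'F_p) : {poly F} := iota i *: 'X.

Lemma xshiftD : {morph xshift : i j / i + j}.
Proof. by move=> i j; rewrite /xshift (Fp_inD charF) scalerDl. Qed.

Lemma xshift_inj : injective xshift.
Proof.
move=> i j /(congr1 (fun q : {poly F} => q`_1)).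
by rewrite !coefZ !coefX eqxx !mulr1 => /(Fp_in_inj charF).
Qed.

(** The element with t = i and s = 0 fixes g; applied to the formula for 2 g, it shifts the part in
    x, y and carries the factor with t = 0 to the one with t = i. *)
Lemma sagbi_g_shift i : 2 * g = bieval mC x y (shift xshift i g_xy) - x * zconj p c22 c23 (iota i).
Proof.
have inv_g : transl (iota i) 0 g = g.
  by rewrite -{1}translU0; apply: ((G_invariantP c22 c23 charF c12_Fp g).1 sagbi_g_inv).
rewrite -{1}inv_g -{1}(rmorph_nat (transl (iota i) 0)) -rmorphM sagbi_g_double //.
rewrite rmorphB rmorphM /= transl_zconj0 transl_x /shift bieval_comp.
rewrite (rmorph_bieval (f' := mC)); last by move=> c; apply: translC.
by rewrite bieval_XaddC /= transl_x transl_y mul_mpolyC.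
Qed.

Lemma bieval_shift_norm : bieval mC x y (shift_norm xshift) = Ny.
Proof.
rewrite (orbit_y c22 c23 charF c12_Fp) /shift_norm rmorph_prod; apply: eq_bigr => i _ /=.
by rewrite -polyCN /xshift -scaleNr bieval_XaddC rmorphN mulNr mul_mpolyC.
Qed.

(** The product over i of T - q(x, y + i x) has coefficients in F[x, N(y)]. At T = 2 g its factors
    are -x times the pieces of N(z). *)
Lemma relation_exists : exists c : nat -> {poly {poly F}},
  (- x) ^+ p * Nz = (2 * g) ^+ p + \sum_(i < p) bieval mC x Ny (c i) * (2 * g) ^+ i.
Proof.
have [c def_c] := norm_shift_coef xshiftD xshift_inj g_xy; exists c.
have cardFp : #|'F_p| = p by apply: card_Fp; case/andP: charF.
have := congr1 (horner_eval (2 * g) \o map_poly (bieval mC x y)) def_c; rewrite cardFp.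
rewrite rmorph_prod rmorphD rmorphXn rmorph_sum /= map_polyX /horner_eval hornerX.
(* Each factor uses its own expression of 2 g, the one shifted by i, so that the part in x, y
   cancels. *)
under eq_bigr => i _.
  rewrite rmorphB /= map_polyX map_polyC /= hornerXsubC (sagbi_g_shift i) addrAC subrr add0r.
  rewrite -mulNr; over.
rewrite big_split prodr_const cardFp -(orbit_z charF p_gt2 c12_Fp translU_inj) => ->.
congr (_ + _); apply: eq_bigr => i _.
by rewrite map_polyZ hornerZ map_polyXn hornerXn /= bieval_comp bieval_shift_norm.
Qed.

(** Since x is the least variable, a power of y exceeds every monomial of the same degree divisible
    by x. *)
Lemma grevlex_x0 (n : nat) (m : 'X_{1..3}) :
  mdeg m = n -> (0 < m 0%R)%N -> grevlex_lt m (U_(1) *+ n)%MM.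
Proof.
move=> dm m0; apply/grevlex_ltP; right; rewrite mdegMn mdeg1 mul1n dm; split=> //.
by exists 0; rewrite mulmnE mnm1E.
Qed.

Lemma grevlex_01 : grevlex_lt U_(0 : 'I_3) U_(1 : 'I_3).
Proof.
by apply/grevlex_ltP; right; rewrite !mdeg1; split=> //; exists 0; rewrite !mnm1E.
Qed.

Lemma grevlex_12 : grevlex_lt U_(1 : 'I_3) U_(2 : 'I_3).
Proof.
apply/grevlex_ltP; right; rewrite !mdeg1; split=> //; exists 1; rewrite !mnm1E.
by split=> // j; rewrite ltnS leqn0 => /eqP j0; rewrite !mnm1E -!val_eqE /= j0.
Qed.

Lemma lead_x : has_lead (@x F) 1 U_(0).
Proof. exact: has_leadX. Qed.

Lemma has_leadDl (n : nat) (f h : {mpoly F[n]}) c m :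
  has_lead f c m -> lower m h -> has_lead (f + h) c m.
Proof. by rewrite /has_lead addrAC; apply: lowerD. Qed.

Lemma lowerX (n : nat) (m m' : 'X_{1..n}) : grevlex_lt m m' -> lower m' ('X_[m] : {mpoly F[n]}).
Proof. by apply: has_lead_lower; apply: has_leadX. Qed.

Lemma lead_Ny : has_lead Ny 1 (U_(1) *+ p).
Proof.
have cardFp : size (index_enum 'F_p) = p.
  by rewrite /index_enum -enumT -cardE card_Fp //; case/andP: charF.
rewrite (orbit_y c22 c23 charF c12_Fp) -[X in (_ *+ X)%MM]cardFp.
apply: has_lead_prod => i; rewrite -scaleNr; apply: has_leadDl; first exact: has_leadX.
by apply/lowerZ/lowerX/grevlex_01.
Qed.

Lemma lead_zconj t : has_lead (zconj p c22 c23 t) 1 (U_(2) *+ p ^ 2).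
Proof.
have card2 : size (index_enum ('F_p * 'F_p)%type) = (p ^ 2)%N.
  rewrite /index_enum -enumT -cardE card_prod card_Fp -?mulnn //.
  by case/andP: charF.
rewrite /zconj -[X in (_ *+ X)%MM]card2; apply: has_lead_prod => jk; rewrite -addrA.
apply: has_leadDl; [exact: has_leadX | apply: lowerD; apply/lowerZ/lowerX].
  exact: grevlex_12.
exact: grevlex_trans grevlex_01 grevlex_12.
Qed.

Lemma lead_Nz : has_lead Nz 1 (U_(2) *+ p ^ 3).
Proof.
have cardFp : size (index_enum 'F_p) = p.
  by rewrite /index_enum -enumT -cardE card_Fp //; case/andP: charF.
rewrite (orbit_z charF p_gt2 c12_Fp translU_inj)
  (_ : (_ *+ p ^ 3)%MM = ((U_(2) *+ p ^ 2) *+ p)%MM); last first.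
  by apply/mnmP => i; rewrite !mulmnE -mulnA -expnSr.
rewrite -[X in (_ *+ X)%MM]cardFp.
by apply: has_lead_prod => i; apply: lead_zconj.
Qed.

(** Besides y^(p^2+1), every term of g either is x times the homogeneous [zconj] or carries an
    explicit positive power of x, always in total degree p^2+1. *)
Lemma lead_g : has_lead g 1 (U_(1) *+ (p ^ 2 + 1)).
Proof.
have -> : g = y ^+ (p ^ 2 + 1) + 2^-1 *: ((1 + A) *: (x ^+ (p.-1 ^ 2) * y ^+ (2 * p))
    - 2 *: (x ^+ (p * p.-1) * y ^+ p.+1) + B *: (x ^+ (p ^ 2 - 1) * y ^+ 2)
    - x * zconj p c22 c23 0).
  apply: (mulfI two_mpoly_neq0); rewrite sagbi_g_double // bieval_g_xy mulrDr -[in RHS]mul_mpolyC.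
  rewrite [in RHS]mulrA -[in X in X * _%:MP * _](rmorph_nat mC) -mpolyCM.
  rewrite mulfV ?(two_neq0 charF p_gt2) // mul1r -!mul_mpolyC rmorph_nat; ring.
apply: has_leadDl; first by rewrite /y mpolyXn; apply: has_leadX.
have low_xy a b : (0 < a)%N -> (a + b = p ^ 2 + 1)%N ->
    lower (U_(1) *+ (p ^ 2 + 1)) (x ^+ a * y ^+ b : {mpoly F[3]}).
  move=> a0 ab; rewrite /x /y !mpolyXn -mpolyXD; apply/lowerX/grevlex_x0.
    by rewrite mdegD !mdegMn !mdeg1 !mul1n.
  by rewrite mnmDE !mulmnE !mnm1E /= mul0n addn0 mul1n.
apply: lowerZ; apply: lowerD; first apply: lowerD; first apply: lowerD.
- by apply/lowerZ/low_xy; nia.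
- by rewrite -scaleNr; apply/lowerZ/low_xy; nia.
- by apply/lowerZ/low_xy; nia.
rewrite -scaleN1r; apply: lowerZ.
apply: has_lead_lower (has_leadM lead_x (@lead_zconj 0)) _; apply: grevlex_x0.
  by rewrite mdegD mdegMn !mdeg1 mul1n addnC.
by rewrite mnmDE mulmnE !mnm1E.
Qed.

End GeneratorInvariance.

(** * The subalgebra generated by x, N(y), g, N(z) *)

Section DegreeBound.
Variables (F : fieldType) (k : nat) (i : 'I_k).
Implicit Types P Q : {mpoly F[k]}.

Definition deg_le d P := {in msupp P, forall m : 'X_{1..k}, (m i <= d)%N}.

Lemma deg_le_trans d e P : (d <= e)%N -> deg_le d P -> deg_le e P.
Proof. by move=> le_de dP m /dP le_m; apply: leq_trans le_de. Qed.

Lemma deg_leX d (m : 'X_{1..k}) : (m i <= d)%N -> deg_le d ('X_[m] : {mpoly F[k]}).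
Proof. by move=> le_m m'; rewrite msuppX inE => /eqP ->. Qed.

Lemma deg_leD d P Q : deg_le d P -> deg_le d Q -> deg_le d (P + Q).
Proof. by move=> dP dQ m /msuppD_le; rewrite mem_cat => /orP[/dP|/dQ]. Qed.

Lemma deg_leZ d c P : deg_le d P -> deg_le d (c *: P).
Proof. by move=> dP m /msuppZ_le/dP. Qed.

Lemma deg_le_sum d (I : Type) (s : seq I) (E : I -> {mpoly F[k]}) :
  (forall j, deg_le d (E j)) -> deg_le d (\sum_(j <- s) E j).
Proof.
move=> dE; elim/big_ind: _ => // [m|P Q]; last exact: deg_leD.
by rewrite msupp0.
Qed.

Lemma deg_leM d e P Q : deg_le d P -> deg_le e Q -> deg_le (d + e) (P * Q).
Proof.
move=> dP dQ m /msuppM_le/allpairsP[[m1 m2] /= [/dP le1 /dQ le2 ->]].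
by rewrite mnmDE leq_add.
Qed.

Lemma deg_leC d c : deg_le d (c%:MP).
Proof.
move=> m; rewrite msuppC; case: ifP => // _.
by rewrite inE => /eqP ->; rewrite mnm0E.
Qed.

Lemma deg_leXn d n P : deg_le d P -> deg_le (n * d) (P ^+ n).
Proof.
move=> dP; elim: n => [|n IHn]; first by rewrite expr0 -mpolyC1; apply: deg_leC.
by rewrite exprS mulSn; apply: deg_leM.
Qed.

Lemma deg_le_bieval (a b : {mpoly F[k]}) q :
  deg_le 0 a -> deg_le 0 b -> deg_le 0 (bieval (@mpolyC k F) a b q).
Proof.
move=> da db; elim/bieval_ind: q => [c|||q1 q2 IH1 IH2|q1 q2 IH1 IH2].
- by rewrite bieval_const; apply: deg_leC.
- by rewrite bieval_x.
- by rewrite bieval_y.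
- by rewrite rmorphD; apply: deg_leD.
- by rewrite rmorphM; apply: (@deg_leM 0 0).
Qed.

(* Division by a polynomial that is monic of degree d.+1 in the i-th variable. *)
Lemma deg_le_divide d (S : {mpoly F[k]}) : deg_le d S -> forall P,
  exists Q R, P = Q * ('X_i ^+ d.+1 - S) + R /\ deg_le d R.
Proof.
move=> dS P.
(* The induction is on a bound for the degree in the i-th variable. *)
have [N] : exists N, deg_le N P.
  exists (\max_(m <- msupp P) m i) => m mP.
  by apply: (@leq_bigmax_seq _ _ xpredT (fun m : 'X_{1..k} => m i)).
elim: N P => [|N IHN] P dP.
  by exists 0, P; rewrite mul0r add0r; split=> // m /dP; rewrite leqn0 => /eqP ->.
rewrite (mpolyE P) big_seq; elim/big_ind: _ => [|P1 P2 [Q1 [R1 [-> dR1]]] [Q2 [R2 [-> dR2]]]|m mP].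
- by exists 0, 0; rewrite mul0r addr0; split=> // m; rewrite msupp0.
- exists (Q1 + Q2), (R1 + R2); split; last exact: deg_leD.
  by rewrite mulrDl addrACA.
have [le_md|lt_dm] := leqP (m i) d.
  by exists 0, (P@_m *: 'X_[m]); rewrite mul0r add0r; split=> //; apply/deg_leZ/deg_leX.
pose m' := (m - U_(i) *+ d.+1)%MM.
have defm : m = (m' + U_(i) *+ d.+1)%MM.
  apply/mnmP => j; rewrite mnmDE mnmBE mulmnE mnm1E subnK //.
  by case: eqP => [<-|_]; rewrite ?mul1n ?mul0n.
have m'i : m' i = (m i - d.+1)%N by rewrite mnmBE mulmnE mnm1E eqxx mul1n.
(* Replacing the (d+1)-st power of the variable by S, of degree at most d, lowers the degree of the
   term. *)
have [|Q [R [defS dR]]] := IHN ('X_[m'] * S).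
  have := dP m mP => le_m; apply: deg_le_trans (deg_leM (deg_leX (leqnn (m' i))) dS).
  by rewrite m'i; lia.
exists (P@_m *: ('X_[m'] + Q)), (P@_m *: R); split; last exact: deg_leZ.
rewrite -scalerAl -scalerDr; congr (_ *: _).
rewrite mulrDl -addrA -defS {1}defm mpolyXD -mpolyXn mulrBr; ring.
Qed.

End DegreeBound.

Lemma ord4P (P : 'I_4 -> Prop) : P 0 -> P 1 -> P 2 -> P 3 -> forall i, P i.
Proof.
move=> P0 P1 P2 P3 [[|[|[|[|//]]]] lti].
- by rewrite (_ : Ordinal lti = 0) //; apply/val_inj.
- by rewrite (_ : Ordinal lti = 1) //; apply/val_inj.
- by rewrite (_ : Ordinal lti = 2) //; apply/val_inj.
- by rewrite (_ : Ordinal lti = 3) //; apply/val_inj.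
Qed.

Lemma big_ord4 (T : Type) (idx : T) (op : Monoid.law idx) (f : 'I_4 -> T) :
  \big[op/idx]_i f i = op (f 0) (op (f 1) (op (f 2) (f 3))).
Proof.
rewrite !big_ord_recl big_ord0 Monoid.mulm1.
by congr (op (f _) (op (f _) (op (f _) (f _)))); apply/val_inj.
Qed.

(** * Normal forms modulo the relation, and their consequences *)

Section Subalgebra.
Variables (F : fieldType) (p : nat) (N g Z : {mpoly F[3]}) (S : {mpoly F[4]}).
Hypothesis p_gt0 : (0 < p)%N.
Hypotheses (lead_N : has_lead N 1 (U_(1) *+ p)) (lead_g : has_lead g 1 (U_(1) *+ (p ^ 2 + 1)))
  (lead_Z : has_lead Z 1 (U_(2) *+ p ^ 3)).
Let B := [tuple x; N; g; Z].
Hypotheses (degS : deg_le 2 p.-1 S) (gS : g ^+ p = S \mPo B).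

Definition gen_lead (i : 'I_4) : 'X_{1..3} :=
  nth 0%MM
  [:: U_(0%R)%MM; (U_(1) *+ p)%MM; (U_(1) *+ (p ^ 2 + 1))%MM; (U_(2) *+ p ^ 3)%MM] i.

Lemma lead_gens i : has_lead (tnth B i) 1 (gen_lead i).
Proof. by elim/ord4P: i; rewrite (tnth_nth 0) //=; apply: has_leadX. Qed.

Lemma gens_leadE (I : 'X_{1..4}) :
  [/\ mon_lead gen_lead I 0 = I 0,
      mon_lead gen_lead I 1 = (p * I 1%R + (p ^ 2 + 1) * I 2%R)%N
    & mon_lead gen_lead I 2 = (p ^ 3 * I 3%R)%N].
Proof.
rewrite /mon_lead big_ord4 /=.
split; rewrite /gen_lead /= !mnmDE !mulmnE !mnm1E /=; lia.
Qed.

(** The bound has the shape of [deg_le 2 p.-1], so remainders of the division are normal in the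
    sense of [all_normal]. *)
Definition low : pred 'X_{1..4} := fun I => (I 2%R <= p.-1)%N.

(* The exponent of y in the lead monomial is congruent to I_2 modulo p. *)
Lemma mon_lead_inj : {in low &, injective (mon_lead gen_lead)}.
Proof.
move=> I J lowI lowJ eqIJ; have [I0 I1 I2] := gens_leadE I; have [J0 J1 J2] := gens_leadE J.
move: I0 I1 I2; rewrite eqIJ J0 J1 J2 => e0 e1 e3.
have eI2 : I 2%R = J 2%R.
  have ltI : (I 2%R < p)%N by move: lowI; rewrite /low unfold_in; lia.
  have ltJ : (J 2%R < p)%N by move: lowJ; rewrite /low unfold_in; lia.
  rewrite -(modn_small ltI) -(modn_small ltJ).
  have mod_p a b : (p * a + (p ^ 2 + 1) * b = b %[mod p])%N.
    by rewrite mulnDl mul1n expnS expn1 -mulnA addnA -mulnDr mulnC modnMDl.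
  by rewrite -(mod_p (I 1%R) (I 2%R)) -(mod_p (J 1%R) (J 2%R)) -e1.
apply/mnmP; apply: ord4P => //.
  by move: e1; rewrite eI2 => /addIn/eqP; rewrite eqn_pmul2l // => /eqP ->.
by move/eqP: e3; rewrite eqn_pmul2l ?expn_gt0 ?p_gt0 // => /eqP ->.
Qed.

Lemma rel_eq0 : ('X_2 ^+ p.-1.+1 - S) \mPo B = 0.
Proof.
by rewrite comp_mpolyB rmorphXn /= comp_mpolyXU (prednK p_gt0) gS subrr.
Qed.

Lemma normal_form_exists P :
  exists Q R, [/\ P = Q * ('X_2 ^+ p.-1.+1 - S) + R, deg_le 2 p.-1 R & P \mPo B = R \mPo B].
Proof.
have [Q [R [defP dR]]] := deg_le_divide degS P; exists Q, R; split=> //.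
by rewrite defP comp_mpolyD rmorphM /= rel_eq0 mulr0 add0r.
Qed.

Definition in_gens f := exists P, f = P \mPo B.

Lemma in_gens_lead f : in_gens f -> f != 0 -> exists I : 'X_{1..4}, lead_mon f = mon_lead gen_lead I.
Proof.
move=> [P defP] f0; have [Q [R [_ dR PR]]] := normal_form_exists P.
have R0 : R != 0 by apply: contraNneq f0 => R0; rewrite defP PR R0 comp_mpoly0.
have [I IR lI] := lead_comp lead_gens mon_lead_inj dR R0; exists I.
move: IR; rewrite mcoeff_msupp => cI; have [_ <-] := lead_mon_uniq cI lI.
by rewrite defP PR.
Qed.

(** Split the normal form of x f as R0 + X_0 R1 with R0 free of X_0. Then R0 evaluates to a multiple
    of x, but no lead monomial of a normal term free of X_0 involves x. Hence R0 = 0, and R1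
    represents f. *)
Lemma in_gens_divx f : in_gens (x * f) -> in_gens f.
Proof.
move=> [P defP]; have [Q [R [_ dR PR]]] := normal_form_exists P.
pose R0 := \sum_(m <- msupp R | m 0%R == 0%N) R@_m *: 'X_[m].
pose R1 := \sum_(m <- msupp R | m 0%R != 0%N) R@_m *: 'X_[m - U_(0)].
have defR : R = R0 + 'X_0 * R1.
  rewrite {1}(mpolyE R) (bigID (fun m : 'X_{1..4} => m 0%R == 0%N)) /=; congr (_ + _).
  rewrite mulr_sumr; apply: eq_bigr => m m0; rewrite -scalerAr -mpolyXD; congr (_ *: 'X_[_]).
  apply/mnmP => j; rewrite mnmDE mnmBE mnm1E subnKC //.
  by case: eqP => [<-|//]; rewrite lt0n.
have suppR0 m : m \in msupp R0 -> m 0%R = 0%N /\ m \in msupp R.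
  move=> /msupp_sum_le/flatten_mapP[m']; rewrite mem_filter => /andP[/eqP m'0 m'R].
  by move=> /msuppZ_le; rewrite msuppX inE => /eqP ->.
have dR0 : deg_le 2 p.-1 R0 by move=> m /suppR0[_ /dR].
have eqR0 : R0 \mPo B = x * (f - (R1 \mPo B)).
  apply/eqP; rewrite mulrBr eq_sym subr_eq defP PR {1}defR comp_mpolyD rmorphM /=.
  by rewrite comp_mpolyXU.
suff R00 : R0 = 0.
  exists R1; apply/(mulfI (x_neq0 F)).
  by rewrite defP PR defR R00 add0r rmorphM /= comp_mpolyXU.
apply/eqP; apply: contraT => R0n0.
have [I IR lI] := lead_comp lead_gens mon_lead_inj dR0 R0n0.
have cI : R0@_I != 0 by rewrite -mcoeff_msupp.
have [h0 lh] := lead_mon_uniq cI lI.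
have f0 : f - (R1 \mPo B) != 0 by apply: contraNneq h0 => f0; rewrite eqR0 f0 mulr0.
(* Compare the exponents of x: zero on the side of [R0], positive on the other. *)
have := lead_monM (x_neq0 F) f0; rewrite -eqR0 lh.
have [_ ->] := lead_mon_uniq (oner_neq0 F) (@lead_x F).
move/(congr1 (fun m : 'X_{1..3} => m 0%R)); have [-> _ _] := gens_leadE I.
by have [-> _] := suppR0 I IR; rewrite mnmDE mnm1E.
Qed.

Lemma in_gens_divxn k f : in_gens (x ^+ k * f) -> in_gens f.
Proof.
elim: k => [|k IHk]; first by rewrite mul1r.
by rewrite exprS -mulrA => /in_gens_divx.
Qed.

(** By normal forms, the lead monomial of any nonzero member of A is a product of lead monomials of
    the generators. *)
Lemma gens_sagbi (A : {mpoly F[3]} -> Prop) :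
    (forall f, A f <-> in_gens f) ->
  sagbi_basis A (fun f => f \in B).
Proof.
move=> AB.
have B_A f : f \in B -> A f.
  by case/tnthP=> i ->; apply/AB; exists 'X_i; rewrite comp_mpolyXU -tnth_nth.
split=> // f; split.
  apply: alg_gen_lead_sub => //; first by apply/AB; exists 1; rewrite comp_mpoly1.
  move=> h1 h2 /AB[P1 ->] /AB[P2 ->]; apply/AB; exists (P1 * P2).
  by rewrite rmorphM.
elim=> [|c _ h [f1 [Af1 f10 ->]] _ IHh].
  by rewrite -mpolyC0; apply: alg_gen_const.
apply: alg_gen_add => //; rewrite -mul_mpolyC; apply: alg_gen_mul; first exact: alg_gen_const.
have [I ->] := in_gens_lead ((AB f1).1 Af1) f10.
have X_i i : alg_gen (lead_monomials (fun f => f \in B)) 'X_[gen_lead i].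
  have [l0 <-] := lead_mon_uniq (oner_neq0 F) (@lead_gens i).
  by apply: alg_gen_mem; exists (tnth B i); rewrite mem_tnth.
have X_e i n : alg_gen (lead_monomials (fun f => f \in B)) 'X_[gen_lead i *+ n].
  elim: n => [|n IHn]; first by rewrite mulm0n mpolyX0 -mpolyC1; apply: alg_gen_const.
  by rewrite mulmS mpolyXD; apply: alg_gen_mul.
rewrite /mon_lead big_ord4 /= !mpolyXD.
by do 3!(apply: alg_gen_mul => //).
Qed.

(** On the generators T - X_2^p agrees with the normal polynomial T - S, which subduction therefore
    records. The resulting relation is -(X_2^p - S), and dividing by it leaves a normal remainder,
    which vanishes if its value does. *)
Lemma gens_relation (T : {mpoly F[4]}) : deg_le 2 p.-1 T ->
  exists S0 : {mpoly F[4]}, subducts_to0 B ((T - 'X_2 ^+ p) \mPo B) S0 /\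
    forall P, P \mPo B = 0 <-> exists Q, P = Q * (T - 'X_2 ^+ p - S0).
Proof.
move=> dT; exists (T - S); have nTS : deg_le 2 p.-1 (T - S).
  by apply: deg_leD => //; rewrite -scaleN1r; apply: deg_leZ.
split.
  have -> : (T - 'X_2 ^+ p) \mPo B = (T - S) \mPo B.
    by rewrite !comp_mpolyB rmorphXn /= comp_mpolyXU gS.
  by apply: (subducts_comp lead_gens mon_lead_inj); apply: nTS.
have -> : T - 'X_2 ^+ p - (T - S) = - ('X_2 ^+ p.-1.+1 - S).
  by rewrite (prednK p_gt0); ring.
move=> P; split=> [P0|[Q ->]]; last first.
  by rewrite mulrN comp_mpolyN rmorphM /= rel_eq0 mulr0 oppr0.
have [Q [R [defP dR PR]]] := normal_form_exists P.
have R0 : R = 0.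
  by apply: (comp_normal_eq0 lead_gens mon_lead_inj); rewrite -?PR //; apply: dR.
by exists (- Q); rewrite mulrNN defP R0 addr0.
Qed.

End Subalgebra.

(** * Invariants after inverting x *)

Lemma bieval_XsubC (F : fieldType) (S : comNzRingType) (f : {rmorphism F -> S}) a b c :
  bieval f a b ('X - c%:P%:P) = b - f c.
Proof. by rewrite /bieval /= map_polyXsubC /horner_eval hornerXsubC /= map_polyC /= /horner_eval hornerC. Qed.

Section Localization.
Variables (p : nat) (F : fieldType) (c12 c22 c23 : F).
Hypotheses (charF : p \in [pchar F]) (c12_Fp : c12 ^+ p = c12).
Hypothesis translU_inj : injective (@translU p F c22 c23).
Let M := normal_form c12 c22 c23.
Local Notation iota := (@Fp_in p F).
Local Notation U := (@translU p F c22 c23).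
Local Notation T := {poly {poly {poly F}}}.
Variables (K : fieldType) (tf : {rmorphism {mpoly F[3]} -> K}).
Hypothesis tf_inj : injective tf.

Local Notation mC := (@mpolyC 3 F).

(** From the innermost variable outwards: x, Y, W. The image of z solves delta = y^2 - x z with y =
    x Y and delta = x^2 W. *)
Definition straight_var (i : 'I_3) : T :=
  nth 0 [:: 'X%:P%:P; 'X%:P%:P * 'X%:P; 'X%:P%:P * ('X%:P ^+ 2 - 'X)] i.

(* In the coordinates x, Y = y / x and W = delta / x^2 the group acts by the
   independent translations Y -> Y + t and W -> W - s. *)
Definition straighten (f : {mpoly F[3]}) : T :=
  mmap (polyC \o polyC \o polyC) straight_var f.

HB.instance Definition _ := GRing.RMorphism.copy straighten
  (mmap (polyC \o polyC \o polyC) straight_var).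

Lemma straightenC c : straighten c%:MP = c%:P%:P%:P.
Proof. by rewrite /straighten mmapC. Qed.
Lemma straighten_x : straighten x = 'X%:P%:P.
Proof. by rewrite /straighten mmapX mmap1U. Qed.
Lemma straighten_y : straighten y = 'X%:P%:P * 'X%:P.
Proof. by rewrite /straighten mmapX mmap1U. Qed.
Lemma straighten_z : straighten z = 'X%:P%:P * ('X%:P ^+ 2 - 'X).
Proof. by rewrite /straighten mmapX mmap1U. Qed.

Definition straightenE := (straighten_x, straighten_y, straighten_z).

Lemma straighten_translT t f :
  straighten (transl t 0 f) = map_poly (comp_poly ('X + t%:P%:P)) (straighten f).
Proof.
apply: (rmorph_xyz_eq (f := straighten \o transl t 0)
  (g := map_poly (comp_poly ('X + t%:P%:P)) \o straighten)) => [c|||] /=.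
- by rewrite translC straightenC map_polyC /= comp_polyC.
- by rewrite transl_x straighten_x map_polyC /= comp_polyC.
- rewrite transl_y rmorphD /= -mul_mpolyC rmorphM /= straightenC !straightenE.
  rewrite rmorphM /= !map_polyC /= comp_polyC comp_polyX polyCD; ring.
rewrite transl_z !rmorphD /= -!mul_mpolyC !rmorphM /= !straightenC !straightenE.
rewrite rmorphM rmorphB rmorphXn /= map_polyX !map_polyC /= comp_polyC comp_polyX polyCD.
rewrite addr0 !polyC_exp !polyCD !polyC1; ring.
Qed.

(** The sign is reversed because delta goes to delta - s x^2. *)
Lemma straighten_translU s f : straighten (transl 0 (- s) f) = straighten f \Po ('X + s%:P%:P%:P).
Proof.
apply: (rmorph_xyz_eq (f := straighten \o transl 0 (- s))
  (g := comp_poly ('X + s%:P%:P%:P) \o straighten)) => [c|||] /=.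
- by rewrite translC straightenC comp_polyC.
- by rewrite transl_x straighten_x comp_polyC.
- by rewrite transl_y scale0r addr0 straighten_y -polyCM comp_polyC.
rewrite transl_z mulr0 scale0r addr0 expr0n add0r rmorphD /= -mul_mpolyC rmorphM /=.
rewrite straightenC !straightenE rmorphM rmorphB rmorphXn /= comp_polyX !comp_polyC.
rewrite !polyCN; ring.
Qed.

(** The substitution back takes place in a field containing F[x, y, z], where y / x and delta / x^2
    exist. *)
Definition unstraighten (h : T) : K :=
  (horner_eval (tf delta / tf x ^+ 2) \o
   map_poly (bieval (tf \o @mpolyC 3 F) (tf x) (tf y / tf x))) h.

HB.instance Definition _ := GRing.RMorphism.copy unstraighten
  (horner_eval (tf delta / tf x ^+ 2) \o
   map_poly (bieval (tf \o @mpolyC 3 F) (tf x) (tf y / tf x))).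

Lemma unstraightenC q : unstraighten q%:P = bieval (tf \o @mpolyC 3 F) (tf x) (tf y / tf x) q.
Proof. by rewrite /unstraighten /= map_polyC /horner_eval hornerC. Qed.

Lemma unstraightenX : unstraighten 'X = tf delta / tf x ^+ 2.
Proof. by rewrite /unstraighten /= map_polyX /horner_eval hornerX. Qed.

Lemma unstraighten_XsubC q : unstraighten ('X - q%:P) =
  tf delta / tf x ^+ 2 - bieval (tf \o @mpolyC 3 F) (tf x) (tf y / tf x) q.
Proof. by rewrite /unstraighten /= map_polyXsubC /horner_eval hornerXsubC. Qed.

Lemma tfx_neq0 : tf x != 0.
Proof. by rewrite -(rmorph0 tf) (inj_eq tf_inj) x_neq0. Qed.

Lemma straightenK f : unstraighten (straighten f) = tf f.
Proof.
apply: (rmorph_xyz_eq (f := unstraighten \o straighten) (g := tf)) => [c|||] /=.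
- by rewrite straightenC unstraightenC bieval_const.
- by rewrite straighten_x unstraightenC bieval_x.
- rewrite straighten_y -polyCM unstraightenC rmorphM /= bieval_x bieval_y.
  by rewrite mulrC divfK ?tfx_neq0.
rewrite straighten_z rmorphM rmorphB rmorphXn /= !unstraightenC unstraightenX.
rewrite bieval_x bieval_y /delta rmorphB rmorphXn rmorphM /=.
by field; apply: tfx_neq0.
Qed.

(** Straightened, f is invariant under both groups of translations, hence a polynomial in x and the
    two norms. These norms are N(y) / x^p and N(delta) / x^(2p^2), and a power of x clears the
    denominators. *)
Lemma invariant_localized (C : {mpoly F[3]} -> Prop) f :
    (forall c, C c%:MP) -> (forall f1 f2, C f1 -> C f2 -> C (f1 + f2)) ->
    (forall f1 f2, C f1 -> C f2 -> C (f1 * f2)) ->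
    C x -> C (orbit_prod p M y) -> C (orbit_prod p M delta) ->
  G_invariant p M f -> exists k, C (x ^+ k * f).
Proof.
move=> CC CD CM Cx Cy Cd /(G_invariantP c22 c23 charF c12_Fp) inv_f.
have CXn e k : C e -> C (e ^+ k).
  move=> Ce; elim: k => [|k IHk]; first by rewrite expr0 -mpolyC1; apply: (CC).
  by rewrite exprS; apply: (CM).
(* The elements that come from C after multiplication by a power of x; they form a subalgebra. *)
pose G h := exists k e, C e /\ tf x ^+ k * unstraighten h = tf e.
suff [k [e [Ce def_e]]] : G (straighten f).
  exists k; suff -> : x ^+ k * f = e by [].
  by apply: tf_inj; rewrite -def_e rmorphM rmorphXn /= straightenK.
have GD h1 h2 : G h1 -> G h2 -> G (h1 + h2).
  move=> [k1 [e1 [C1 E1]]] [k2 [e2 [C2 E2]]].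
  exists (k1 + k2)%N, (x ^+ k2 * e1 + x ^+ k1 * e2); split.
    by apply: (CD); apply: (CM) => //; apply: CXn.
  rewrite rmorphD [in RHS]rmorphD !(rmorphM tf) !(rmorphXn tf) -E1 -E2 exprD /=; ring.
have GM h1 h2 : G h1 -> G h2 -> G (h1 * h2).
  move=> [k1 [e1 [C1 E1]]] [k2 [e2 [C2 E2]]].
  exists (k1 + k2)%N, (e1 * e2); split; first exact: (CM).
  rewrite rmorphM (rmorphM tf) -E1 -E2 exprD /=; ring.
pose r (i : 'F_p) : {poly F} := (iota i)%:P.
pose s jk : {poly F} := (U jk)%:P.
have tfscale (c : F) (h : {mpoly F[3]}) : tf (c *: h) = tf c%:MP * tf h by rewrite -mul_mpolyC rmorphM.
apply: (@double_shift_ind _ _ _ r s) => //.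
- by move=> i j; rewrite /r (Fp_inD charF) polyCD.
- by move=> i j; rewrite /s translU_add // polyCD.
- by move=> i j /polyC_inj/(Fp_in_inj charF).
- by move=> i j /polyC_inj/translU_inj.
- elim/poly_ind => [|c d IHc].
    exists 0%N, 0; rewrite -mpolyC0; split=> //.
    by rewrite mpolyC0 !rmorph0 mulr0.
  rewrite polyCD polyCM polyCD polyCM.
  apply: (GD); [apply: (GM); [exact: IHc|] |].
    by exists 0%N, x; split; [exact: Cx | rewrite mul1r unstraightenC bieval_x].
  by exists 0%N, d%:MP; split; [exact: CC | rewrite mul1r unstraightenC bieval_const].
- exists p, (orbit_prod p M y); split=> //.
  have cardFp : #|'F_p| = p by apply: card_Fp; case/andP: charF.
  rewrite unstraightenC (orbit_y c22 c23 charF c12_Fp) /shift_norm !rmorph_prod /=.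
  rewrite -[in X in X * _]cardFp -prodr_const -big_split; apply: eq_bigr => i _ /=.
  have -> : bieval (tf \o mC) (tf x) (tf y / tf x) ('X - (r i)%:P) =
      tf y / tf x - tf (mC (iota i)) by exact: bieval_XsubC.
  rewrite (rmorphB tf) tfscale.
  by rewrite mulrBr mulrC divfK ?expf_neq0 ?tfx_neq0 // [_ * tf _]mulrC.
(* One factor x^2 for each element of U. *)
- exists (2 * #|{: 'F_p * 'F_p}|)%N, (orbit_prod p M delta); split=> //.
  rewrite (orbit_delta charF c12_Fp translU_inj) /shift_norm !rmorph_prod /=.
  rewrite exprM -prodr_const -big_split; apply: eq_bigr => i _ /=.
  have -> : unstraighten (map_poly polyC ('X - (s i)%:P)) =
      tf delta / tf x ^+ 2 - tf (mC (U i)).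
    by rewrite map_polyXsubC /= unstraighten_XsubC bieval_const.
  rewrite [in RHS]rmorphB /= tfscale (rmorphXn tf).
  by rewrite mulrBr mulrC divfK ?expf_neq0 ?tfx_neq0 // [_ * tf _]mulrC.
- move=> i; rewrite -straighten_translT; congr straighten.
  by have := inv_f i 0; rewrite translU0.
move=> k; rewrite -straighten_translU; congr straighten.
have := inv_f 0 (- k); rewrite Fp_in0.
suff -> : U (- k) = - U k by [].
by apply/eqP; rewrite -addr_eq0 -translU_add // addNr translU0.
Qed.

End Localization.

(** * The theorem *)

Lemma det_mx33 (R : comNzRingType) (A : 'M[R]_3) :
  \det A = A 0 0 * (A 1 1 * A 2 2 - A 1 2 * A 2 1)
    - A 0 1 * (A 1 0 * A 2 2 - A 1 2 * A 2 0) + A 0 2 * (A 1 0 * A 2 1 - A 1 1 * A 2 0).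
Proof.
pose a (i j : nat) := A (inord i) (inord j).
have AE i j : A i j = a i j by rewrite /a !inord_val.
rewrite (expand_det_row A 0) !big_ord_recl big_ord0 /cofactor.
rewrite !(expand_det_row _ 0) !big_ord_recl !big_ord0 /cofactor !det_mx11 !mxE !AE /=.
rewrite /bump /=; ring.
Qed.

(** * What the minors say about the entries of the normal form *)

Section NormalForm.
Variables (p : nat) (F : fieldType) (c12 c22 c23 : F).
Hypothesis charF : p \in [pchar F].
Let M := normal_form c12 c22 c23.

Lemma gamma123E : gamma p M 1 2 3 = c23 * (c12 - c12 ^+ p).
Proof.
have p_gt0 : (0 < p)%N by case/andP: charF => /prime_gt0.
rewrite /gamma det_mx33 !mxE /=.
rewrite !expr1 !expr1n expn1 expr0n eqn0Ngt p_gt0 /=.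
ring.
Qed.

Lemma gamma124E : gamma p M 1 2 4 = c22 * c23 ^+ p - c23 * c22 ^+ p.
Proof.
have p_gt0 : (0 < p)%N by case/andP: charF => /prime_gt0.
rewrite /gamma det_mx33 !mxE /=.
rewrite !expr1 expn1 expr0n eqn0Ngt p_gt0 /=.
ring.
Qed.

(** A dependence of c22, c23 over F_p and its p-th power form a linear system in the two
    coefficients, with determinant the minor on rows 1, 2, 4; Cramer's rule gives independence. *)
Lemma translU_inj_gamma : gamma p M 1 2 4 <> 0 -> injective (@translU p F c22 c23).
Proof.
rewrite gamma124E => /eqP g124.
have ker (jk : 'F_p * 'F_p) : translU c22 c23 jk = 0 -> jk = 0.
  case: jk => j k; rewrite /translU /= => U0.
  have U0p : Fp_in F j * c22 ^+ p + Fp_in F k * c23 ^+ p = 0.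
    have := congr1 (fun u => u ^+ p) U0; rewrite (exprD_p charF) !exprMn !(Fp_in_exp charF).
    by move=> ->; rewrite expr0n eqn0Ngt; case/andP: charF => /prime_gt0 ->.
  have j0 : Fp_in F j = 0.
    apply: (mulIf g124); rewrite mul0r.
    transitivity ((Fp_in F j * c22 + Fp_in F k * c23) * c23 ^+ p
      - (Fp_in F j * c22 ^+ p + Fp_in F k * c23 ^+ p) * c23); first ring.
    by rewrite U0 U0p !mul0r subrr.
  have k0 : Fp_in F k = 0.
    apply: (mulIf g124); rewrite mul0r.
    transitivity ((Fp_in F j * c22 ^+ p + Fp_in F k * c23 ^+ p) * c22
      - (Fp_in F j * c22 + Fp_in F k * c23) * c22 ^+ p); first ring.
    by rewrite U0 U0p !mul0r subrr.
  by move/eqP: j0; rewrite (Fp_in_eq0 charF) => /eqP ->; move/eqP: k0;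
    rewrite (Fp_in_eq0 charF) => /eqP ->.
move=> i j eq_ij; apply/eqP; rewrite -subr_eq0; apply/eqP/ker.
have := translU_add c22 c23 charF (i - j) j; rewrite subrK eq_ij => /eqP.
by rewrite -subr_eq subrr eq_sym => /eqP.
Qed.

(** If c23 were 0, the second minor would vanish; so the factor c12 - c12^p of the first one is
    0. *)
Lemma c12_Fp_gamma : gamma p M 1 2 3 = 0 -> gamma p M 1 2 4 <> 0 -> c12 ^+ p = c12.
Proof.
rewrite gamma123E gamma124E => /eqP; rewrite mulf_eq0 => /orP[/eqP ->|].
  rewrite expr0n eqn0Ngt; case/andP: charF => /prime_gt0 -> _.
  by rewrite !(mulr0, mul0r) subrr.
by rewrite subr_eq0 => /eqP.
Qed.

End NormalForm.

Theorem theorem8p10 (p : nat) (F : fieldType) (M : 'M[F]_(2, 3))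
    (c12 c22 c23 : F)
    (p_prime : prime p) (p_gt2 : (2 < p)%N) (charF : p \in [pchar F])
    (M_faithful : faithful p M)
    (gamma123 : gamma p M 1 2 3 = 0)
    (gamma135 : gamma p M 1 3 5 = 0)
    (gamma124 : gamma p M 1 2 4 <> 0)
    (M_form : M = normal_form c12 c22 c23) :
  exists g : {mpoly F[3]},
    2 * x ^+ (p ^ 2 - 1) * g = gtilde p M /\
    let B := [tuple x; orbit_prod p M y; g; orbit_prod p M z] in
    sagbi_basis (G_invariant p M) (fun f => f \in B) /\
    exists S : {mpoly F[4]},
      let F0 : {mpoly F[4]} := 'X_(1 : 'I_4) ^+ (p ^ 2 + 1) - 'X_(2 : 'I_4) ^+ p in
      subducts_to0 B (F0 \mPo B) S /\
      forall P : {mpoly F[4]},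
        P \mPo B = 0 <-> exists Q : {mpoly F[4]}, P = Q * (F0 - S).
Proof.
subst M; have p_gt0 : (0 < p)%N by lia.
have c12_Fp := c12_Fp_gamma charF gamma123 gamma124.
have translU_inj := translU_inj_gamma charF gamma124.
have [A [B planeE]] := @prod_Fp_plane p F {mpoly F[3]} (@mpolyC 3 F) charF c22 c23.
have [c rel_c] := relation_exists charF p_gt2 c12_Fp translU_inj planeE.
have gE := sagbi_gE charF p_gt2 c12_Fp translU_inj planeE.
have g_inv := sagbi_g_inv charF p_gt2 c12_Fp translU_inj planeE.
have lN := @lead_Ny _ _ _ c22 c23 charF c12_Fp.
have lZ := @lead_Nz _ _ _ _ _ charF p_gt2 c12_Fp translU_inj.
have lg := @lead_g _ _ c22 c23 charF p_gt2 A B.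
set g := sagbi_g p c22 c23 A B in rel_c gE g_inv lg.
exists g; split=> //; set M := normal_form c12 c22 c23 in rel_c gE g_inv lN lZ *.
set Ny := orbit_prod p M y in rel_c lN *; set Nz := orbit_prod p M z in rel_c lZ *.
move=> Bs.
(* The relation [rel_c] solved for g^p; the scalar comes from (2 g)^p. *)
pose S' : {mpoly F[4]} := (2 ^+ p)^-1 *: ((- 'X_0) ^+ p * 'X_3 -
  \sum_(i < p) bieval (@mpolyC 4 F) 'X_0 'X_1 (c i) * (2 * 'X_2) ^+ i).
have two0 := two_neq0 charF p_gt2.
have degS : deg_le 2 p.-1 S'.
  apply/deg_leZ/deg_leD.
    rewrite -scaleN1r exprZn -scalerAl; apply: deg_leZ; rewrite mpolyXn -mpolyXD.
    by apply: deg_leX; rewrite mnmDE mulmnE !mnm1E.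
  rewrite -scaleN1r; apply/deg_leZ/deg_le_sum => i.
  apply: (@deg_le_trans _ _ _ (0 + i * 1)); first by have := ltn_ord i; lia.
  apply: deg_leM; first by apply: deg_le_bieval; apply: deg_leX; rewrite mnm1E.
  apply: deg_leXn; rewrite -(rmorph_nat (@mpolyC 4 F)) mul_mpolyC.
  by apply/deg_leZ/deg_leX; rewrite mnm1E.
have gS : g ^+ p = S' \mPo Bs.
  rewrite comp_mpolyZ comp_mpolyB rmorphM rmorphXn rmorphN rmorph_sum /= !comp_mpolyXU /=.
  rewrite rel_c [X in _ - X](eq_bigr (fun i : 'I_p => bieval (@mpolyC 3 F) x Ny (c i) * (2 * g) ^+ i)).
    have -> : (2 * g) ^+ p = (2 ^+ p)%:MP * g ^+ p by rewrite exprMn rmorphXn rmorph_nat.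
    rewrite addrK mul_mpolyC scalerA.
    by rewrite mulVf ?scale1r // expf_neq0.
  move=> i _; rewrite rmorphM rmorphXn rmorphM rmorph_nat /= comp_mpolyXU /=.
  rewrite (rmorph_bieval (f' := @mpolyC 3 F)) /= ?comp_mpolyXU // => d.
  by rewrite /= comp_mpolyC.
have CX (i : 'I_4) : in_gens Ny g Nz (tnth Bs i).
  by exists 'X_i; rewrite comp_mpolyXU -tnth_nth.
have CC d : in_gens Ny g Nz d%:MP by exists d%:MP; rewrite comp_mpolyC.
have CD f1 f2 : in_gens Ny g Nz f1 -> in_gens Ny g Nz f2 -> in_gens Ny g Nz (f1 + f2).
  by move=> [P1 ->] [P2 ->]; exists (P1 + P2); rewrite comp_mpolyD.
have CM f1 f2 : in_gens Ny g Nz f1 -> in_gens Ny g Nz f2 -> in_gens Ny g Nz (f1 * f2).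
  by move=> [P1 ->] [P2 ->]; exists (P1 * P2); rewrite rmorphM.
have CXn f1 k : in_gens Ny g Nz f1 -> in_gens Ny g Nz (f1 ^+ k).
  by move=> [P1 ->]; exists (P1 ^+ k); rewrite rmorphXn.
have gensE f : G_invariant p M f <-> in_gens Ny g Nz f.
  have Cx : in_gens Ny g Nz x := CX 0.
  have CNy : in_gens Ny g Nz Ny := CX 1.
  have Cg : in_gens Ny g Nz g := CX 2.
  split=> [inv_f|[P ->] a].
    have tf_inj : injective (@tofrac {mpoly F[3]}).
      by move=> f1 f2 /eqP; rewrite tofrac_eq => /eqP.
    have [|k] := invariant_localized charF c12_Fp translU_inj tf_inj CC CD CM Cx CNy _ inv_f.
      have C2 : in_gens Ny g Nz 2 by rewrite -(rmorph_nat (@mpolyC 3 F)); apply: CC.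
      (* The definition of [gtilde] expresses N(delta) through x, N(y) and g. *)
      have -> : orbit_prod p M delta = 2 * x ^+ (p ^ 2 - 1) * g
          + 2 * Ny ^+ p.+1 * x ^+ (p * (p - 1)) + Ny ^+ (2 * p).
        by rewrite gE /gtilde -/M -/Ny !subrK.
      apply: (CD); last exact: CXn.
      apply: (CD); first by apply: (CM) => //; apply: (CM) => //; apply: CXn.
      by apply: (CM); [apply: (CM) => //|]; apply: CXn.
    exact: (in_gens_divxn p_gt0 lN lg lZ degS gS).
  rewrite actE; set t := translT _ _; set s := translU _ _ _.
  (* Both sides are algebra morphisms in P, so invariance need only be checked on the four
     generators. *)
  apply: (mpoly_rmorph_eq (f := transl t s \o comp_mpoly Bs) (g := comp_mpoly Bs)) => [d|i] /=.
    by rewrite comp_mpolyC translC.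
  rewrite comp_mpolyXU -actE; elim/ord4P: i => /=.
  - exact: x_inv.
  - exact: orbit_prod_inv.
  - exact: g_inv.
  - exact: orbit_prod_inv.
split; first exact: (gens_sagbi p_gt0 lN lg lZ degS gS).
(* N(y)^(p^2+1) does not involve g, so it is already in normal form. *)
apply: (gens_relation p_gt0 lN lg lZ degS gS (T := 'X_1 ^+ (p ^ 2 + 1))).
by rewrite mpolyXn; apply: deg_leX; rewrite mulmnE mnm1E.
Qed.
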